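(* Let $d \geq 1$ and let $A$ and $B$ be $d \times d$ complex normal matrices with characteristic polynomials $p(x)$ and $q(x)$ respectively. Let $U$ be a Haar-distributed random $d \times d$ unitary matrix. Then \[ \mathbb{E}_U\, c_x(A U B U^* - U B U^* A) = (p(x) \boxminus_d p(x)) \boxtimes_d (q(x) \boxminus_d q(x)) \boxtimes_d z_d(x), \] where \[ z_d(x) = \sum_{k=0}^{\lfloor d/2 \rfloor} x^{d-2k} \binom{d}{2k} (d)_k \frac{k!}{(2k)!} \frac{d+1-k}{d+1}. \] Equivalently, writing $c_x(X) = \sum_{k=0}^d x^{d-k}(-1)^k \mathsf{e}_k(X)$, for $0 \leq k \leq d$ the expectation $\mathbb{E}_U \mathsf{e}_k(AUBU^* - UBU^*A)$ equals $0$ if $k$ is odd, and if $k$ is even it equals \[ \left( \sum_{i+j=k} (-1)^i \frac{(d-i)! (d-j)!}{d! (d-k)!} \mathsf{e}_i(A) \mathsf{e}_j(A) \right)\left( \sum_{i+j=k} (-1)^i \frac{(d-i)! (d-j)!}{d! (d-k)!} \mathsf{e}_i(B) \mathsf{e}_j(B) \right) \frac{(d-k)!}{(d-k/2)!} (k/2)! \frac{d+1-k/2}{d+1}. \]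
   Context: For a $d\times d$ matrix $X$, $c_x(X)=\det(xI-X)$ is its characteristic polynomial and $\mathsf{e}_k(X)$ is the $k$-th elementary symmetric function of its eigenvalues (with $\mathsf{e}_0=1$). $(d)_k = d(d-1)\cdots(d-k+1)$ is the falling factorial. For monic degree-$d$ polynomials $p(x)=\sum_{k=0}^d x^{d-k}(-1)^k a_k$ and $q(x)=\sum_{k=0}^d x^{d-k}(-1)^k b_k$, define \[ p \boxminus_d q := \sum_{k=0}^d x^{d-k}(-1)^k \sum_{i+j=k} (-1)^j \frac{(d-i)!(d-j)!}{d!(d-k)!} a_i b_j, \qquad p \boxtimes_d q := \sum_{k=0}^d x^{d-k}(-1)^k \frac{a_k b_k}{\binom{d}{k}}. \] ($z_d$ is regarded as $\sum_k x^{d-k}(-1)^k c_k$ with the coefficients read off from the displayed formula.) *)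

(* Defs.v *)
From HB Require Import structures.
From mathcomp Require Import all_boot all_order all_algebra.
From mathcomp Require Import complex.
From mathcomp Require Import all_classical all_reals all_analysis.

Set Implicit Arguments.
Unset Strict Implicit.
Unset Printing Implicit Defensive.

Import Order.TTheory GRing.Theory Num.Theory.
Import numFieldNormedType.Exports.

Local Open Scope classical_set_scope.
Local Open Scope ring_scope.
Local Open Scope complex_scope.

(* [scoef d p k] is the a_k in p = \sum_(k <= d) (-1)^k a_k 'X^(d - k). *)
Definition scoef (F : fieldType) (d : nat) (p : {poly F}) (k : nat) : F :=
  (-1) ^+ k * p`_(d - k).

Definition boxminus (F : fieldType) (d : nat) (p q : {poly F}) : {poly F} :=
  \sum_(k < d.+1)
    ((-1) ^+ k *
     \sum_(i < k.+1)
        (-1) ^+ (k - i) *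
        (((d - i)`! * (d - (k - i))`!)%:R / (d`! * (d - k)`!)%:R) *
        scoef d p i * scoef d q (k - i)) *: 'X^(d - k).

Definition boxtimes (F : fieldType) (d : nat) (p q : {poly F}) : {poly F} :=
  \sum_(k < d.+1)
    ((-1) ^+ k * (scoef d p k * scoef d q k / 'C(d, k)%:R)) *: 'X^(d - k).

Definition zpoly (F : fieldType) (d : nat) : {poly F} :=
  \sum_(k < (d./2).+1)
    ('C(d, 2 * k)%:R * (d ^_ k)%:R * (k`!%:R / (2 * k)`!%:R) *
     ((d + 1 - k)%:R / (d + 1)%:R)) *: 'X^(d - 2 * k).

(* The eigenvalues listed with algebraic multiplicity: a sequence of length d,
   in an unspecified order. *)
Definition eigenvalues (C : numClosedFieldType) (d : nat) (X : 'M[C]_d) :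
    seq C :=
  sval (closed_field_poly_normal (char_poly X)).

Definition elemsym (C : numClosedFieldType) (d : nat) (k : nat)
    (X : 'M[C]_d) : C :=
  \sum_(S : {set 'I_d} | #|S| == k) \prod_(i in S) (eigenvalues X)`_i.

(* d x d complex matrices with their Borel sigma-algebra; [R[i]^o] only serves
   to select the norm topology on the complex field. *)
Definition borelMx (R : realType) (d : nat) :=
  g_sigma_algebraType (@open 'M[R[i]^o]_d).

(* U is a unitary-valued random matrix whose law is the Haar probability
   measure, i.e. the law is invariant under left translations by the unitary
   group (for this compact group, right invariance follows). *)
Definition haar_unitary (R : realType) (disp : measure_display)
    (T : measurableType disp) (P : probability T R) (d : nat)
    (U : T -> 'M[R[i]]_d) : Prop :=
  [/\ measurable_fun [set: T] (U : T -> borelMx R d),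
      forall t, U t \is unitarymx
    & forall V : 'M[R[i]]_d, V \is unitarymx ->
      forall S : set (borelMx R d), measurable S ->
        pushforward P (U : T -> borelMx R d) (mulmx V @^-1` S) =
        pushforward P (U : T -> borelMx R d) S].

Definition expectationC (R : realType) (disp : measure_display)
    (T : measurableType disp) (P : probability T R) (f : T -> R[i]) : R[i] :=
  fine 'E_P[fun t => complex.Re (f t)] +i* fine 'E_P[fun t => complex.Im (f t)].

(* Coefficientwise expectation of a random polynomial of degree at most d. *)
Definition expectationP (R : realType) (disp : measure_display)
    (T : measurableType disp) (P : probability T R) (d : nat)
    (F : T -> {poly R[i]}) : {poly R[i]} :=
  \poly_(j < d.+1) expectationC P (fun t => (F t)`_j).

(* Main.v *)
(** Write M(A, B) for the expected k-th elementary symmetric function of the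
    commutator of A and U B U^*.  Left invariance of U reduces A to a diagonal
    matrix, and since U^* is distributed like U, M(A, B) = (-1)^k M(B, A), so
    that B can be taken diagonal too.  As a function of the diagonal entries a
    of A, M is a combination of products of k differences a_i - a_(s i), with s
    a permutation, and it is symmetric in a.  Such a form is unique up to a
    factor (and zero for odd k): it is determined by its values at the 0/1
    vectors, which are given by a polynomial of degree at most k with k roots
    (k + 1 for odd k).  Hence M(A, B) is a constant times the product of the
    two sums in the statement, and the constant is found by taking for A and B
    the projection on the first m = k/2 coordinates.  There the symmetric
    function is |det|^2 of the top left m x m block of U times a sum of
    |minors|^2 of the block below, and the mixed moments of minors of the first
    m columns follow from the Pluecker exchange relation together with the
    invariance under rotations of two rows. *)

Require Import Defs.
From HB Require Import structures.
From mathcomp Require Import all_boot all_order all_algebra.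
From mathcomp Require Import fingroup perm complex.
From mathcomp Require Import all_classical all_reals all_analysis.
From mathcomp Require Import measurable_realfun zify ring.

Set Implicit Arguments.
Unset Strict Implicit.
Unset Printing Implicit Defensive.

Import Order.TTheory GRing.Theory Num.Theory.
Import numFieldNormedType.Exports.

Local Open Scope ring_scope.

(** Testing on 0/1 vectors suffices because every variable occurs with exponent at most 2. A
    symmetrized monomial of degree k is then fixed by its number s of variables, and its value at a
    vector with n ones is a multiple of the falling factorial n ^_ s; these are linearly
    independent. No integral over the unitary group is ever computed. All integrands are polynomials
    in the entries of U and their conjugates, and the expectation enters only through linearity and
    the substitution of V U for U. The fourth-order moments are therefore found from linear
    relations: for row sets differing in k rows, the exchange relation and the rotations give E
    |minor f|^2 |minor g|^2 = E |minor g|^4 / (k + 1), and the identity that the |minors|^2 have a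
    constant sum fixes the scale. The factor (d + 1 - m) / (d + 1) of the theorem is the ratio of
    'C(d, m) to 'C(d + 1, m); the latter binomial appears when the weights 1 / (k + 1) are summed
    over all row sets. *)

(** * Elementary symmetric functions as coefficients of products *)

Lemma prodD_set (R : comNzRingType) (I : finType) (F G : I -> R) :
  \prod_i (F i + G i) =
  \sum_(S : {set I}) (\prod_(i in S) F i) * \prod_(i in ~: S) G i.
Proof.
rewrite bigA_distr; apply: eq_bigr => S _.
rewrite (bigID (mem S)) /=; congr (_ * _).
  by apply: eq_bigr => i ->.
by apply: eq_big => [i|i /negPf ->//]; rewrite inE.
Qed.

(** The slopes [a i] are kept general for the sake of the characteristic polynomial, where the
    factor of row i is (i == s i) X - X i (s i). *)
Lemma coef_prod_affine (R : comNzRingType) (d k : nat) (a b : 'I_d -> R) :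
  (k <= d)%N ->
  (\prod_i (a i *: 'X + (b i)%:P))`_(d - k) =
  \sum_(S : {set 'I_d} | #|S| == k)
     (\prod_(i in S) b i) * \prod_(i in ~: S) a i.
Proof.
move=> lekd.
under eq_bigr do rewrite addrC.
rewrite prodD_set coef_sum [RHS]big_mkcond; apply: eq_bigr => S _ /=.
rewrite scaler_prod big_const iter_mulr mulr1 -rmorph_prod coefCM coefZ coefXn.
have := cardsC S; rewrite card_ord => dE.
have -> : (d - k == #|~: S|)%N = (#|S| == k).
  by apply/eqP/eqP; move: dE; move: #|S| #|~: S| => x y; lia.
by case: eqP; rewrite ?mulr1 ?mulr0.
Qed.

Definition elem_sym (R : comNzRingType) (d : nat) (a : 'I_d -> R) (k : nat) : R :=
  \sum_(S : {set 'I_d} | #|S| == k) \prod_(i in S) a i.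

Lemma elem_sym_coef (R : comNzRingType) (d k : nat) (a : 'I_d -> R) :
  (k <= d)%N -> elem_sym a k = (\prod_i ('X + (a i)%:P))`_(d - k).
Proof.
move=> lekd; rewrite (eq_bigr (fun i => 1 *: 'X + (a i)%:P)); last first.
  by move=> i _; rewrite scale1r.
rewrite coef_prod_affine //; apply: eq_bigr => S _.
by rewrite [X in _ * X]big1 ?mulr1.
Qed.

Lemma elem_sym_perm (R : comNzRingType) (d k : nat) (a : 'I_d -> R) (t : 'S_d) :
  elem_sym (a \o t) k = elem_sym a k.
Proof.
rewrite /elem_sym (reindex (fun S : {set 'I_d} => t @^-1: S)) /=; last first.
  exists (fun S : {set _} => t @: S) => S _.
    by apply/setP=> x; apply/imsetP/idP => [[y]|Sx]; rewrite ?inE;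
      [move=> ? -> | exists ((t^-1)%g x); rewrite ?inE permKV].
  by apply/setP=> x; rewrite inE mem_imset //; exact: perm_inj.
apply: eq_big => [S|S _]; first by rewrite on_card_preimset //; apply: onW_bij;
  exists (t^-1)%g; [exact: permK | exact: permKV].
by rewrite [RHS](reindex_perm t) /=; apply: eq_bigl => i; rewrite inE.
Qed.

(** Every 0/1 vector is a permutation of one of these, so they are enough to test symmetric forms;
    as a diagonal, it gives a coordinate projection. *)
Definition prefix01 (F : nzRingType) (d n : nat) (i : 'I_d) : F := (i < n)%:R.

Lemma prod_prefix01 (V : comNzRingType) (d n : nat) (h : bool -> V) : (n <= d)%N ->
  \prod_(i < d) h (i < n)%N = h true ^+ n * h false ^+ (d - n).
Proof.
move=> /subnKC <-; move: (d - n)%N => e; rewrite big_split_ord /= addKn.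
congr (_ * _).
  rewrite (eq_bigr (fun=> h true)) ?prodr_const ?card_ord //.
  by move=> i _; rewrite ltn_ord.
rewrite (eq_bigr (fun=> h false)) ?prodr_const ?card_ord //.
by move=> i _; rewrite ltnNge leq_addr.
Qed.

Lemma coef_XaddC_exp (R : comNzRingType) (n j : nat) (y : R) :
  (('X + y%:P) ^+ n)`_j = 'C(n, j)%:R * y ^+ (n - j).
Proof.
rewrite addrC exprDn coef_sum.
have [lejn|ltnj] := leqP j n.
  rewrite (bigD1 (Ordinal (lejn : (j < n.+1)%N))) //= big1 ?addr0; last first.
    move=> i; rewrite -val_eqE /= => nij.
    by rewrite coefMn -rmorphXn coefCM coefXn eq_sym (negPf nij) mulr0 mul0rn.
  by rewrite coefMn -rmorphXn coefCM coefXn eqxx mulr1 mulr_natl.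
rewrite bin_small // mul0r big1 // => i _.
rewrite coefMn -rmorphXn coefCM coefXn gtn_eqF ?mulr0 ?mul0rn //.
by rewrite (leq_ltn_trans _ ltnj) // -ltnS.
Qed.

Lemma elem_sym_prefix01 (F : comNzRingType) (d n k : nat) :
  (n <= d)%N -> (k <= d)%N ->
  elem_sym (@prefix01 F d n) k = 'C(n, k)%:R.
Proof.
move=> lend lekd; rewrite elem_sym_coef //.
rewrite (prod_prefix01 (fun b : bool => 'X + (b%:R)%:P)) //=.
rewrite addr0 coefMXn.
case: ltnP => h; first by rewrite bin_small //; lia.
rewrite coef_XaddC_exp expr1n mulr1; congr _%:R.
have [lekn|ltnk] := leqP k n; last by lia.
by rewrite -(bin_sub lekn); congr 'C(_, _); lia.
Qed.

(** * Symmetrization over permutations of the variables *)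

(** Equal fibre sizes mean that the two tuples of values are rearrangements of each other. *)
Lemma perm_same_fibres (d : nat) (T : eqType) (f g : 'I_d -> T) :
  (forall v, #|[pred i | f i == v]| = #|[pred i | g i == v]|) ->
  exists s : 'S_d, forall i, f i = g (s i).
Proof.
move=> cfg; have : perm_eq [tuple f i | i < d] [tuple g i | i < d].
  apply/allP => v _ /=; rewrite !count_map; apply/eqP.
  have := cfg v; rewrite !cardE !size_filter /= => cE.
  by rewrite -(eq_count (a1 := mem [pred i | f i == v])) ?cE //; apply: eq_count.
case/tuple_permP=> s sE; exists s => i.
have /(congr1 (fun u : d.-tuple T => tnth u i)) := val_inj sE.
by rewrite !tnth_mktuple.
Qed.

Section SymmetrizedMonomials.
Variables (F : comNzRingType) (d : nat).
Implicit Types (T : {set 'I_d}) (a : 'I_d -> F).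

(** The monomial has exponent 2 on the intersection of T1 and T2 and 1 on the rest of their union.
    Two sets suffice: in a product of differences a i - a (s i) a variable is met at most once as a
    i and once as a (s i). *)
Definition sym_monom T1 T2 a : F :=
  \sum_(t : 'S_d) (\prod_(i in T1) a (t i)) * \prod_(i in T2) a (t i).

(** The two cardinals determine how many variables carry each exponent 0, 1, 2, so some permutation
    carries one exponent vector to the other. *)
Lemma sym_monom_card T1 T2 T1' T2' a :
  #|T1 :|: T2| = #|T1' :|: T2'| -> #|T1 :&: T2| = #|T1' :&: T2'| ->
  sym_monom T1 T2 a = sym_monom T1' T2' a.
Proof.
move=> cU cI.
have expE (S1 S2 : {set 'I_d}) (b : 'I_d -> F) :
    (\prod_(i in S1) b i) * \prod_(i in S2) b i =
    \prod_i b i ^+ ((i \in S1) + (i \in S2)).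
  rewrite [X in X * _]big_mkcond [X in _ * X]big_mkcond -big_split /=.
  by apply: eq_bigr => i _; case: (_ \in S1); case: (_ \in S2);
     rewrite ?expr0 ?expr1 ?mulr1 ?mul1r ?expr2.
have cardE (S1 S2 : {set 'I_d}) v :
    #|[pred i | ((i \in S1) + (i \in S2) == v)%N]| =
    (if v == 0 then d - #|S1 :|: S2|
     else if v == 1 then #|S1 :|: S2| - #|S1 :&: S2|
     else if v == 2 then #|S1 :&: S2| else 0)%N.
  case: v => [|[|[|v]]] /=.
  - rewrite -[X in (X - _)%N](card_ord d) -(cardsC (S1 :|: S2)) addKn.
    by apply: eq_card => i; rewrite !inE; case: (_ \in S1); case: (_ \in S2).
  - rewrite -cardsDS; last by apply/fintype.subsetP => i; rewrite !inE => /andP[->].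
    by apply: eq_card => i; rewrite !inE; case: (_ \in S1); case: (_ \in S2).
  - by apply: eq_card => i; rewrite !inE; case: (_ \in S1); case: (_ \in S2).
  - by apply: eq_card0 => i; rewrite !inE; case: (_ \in S1); case: (_ \in S2).
have [v|s sE] := @perm_same_fibres d _ (fun i => (i \in T1) + (i \in T2))%N
   (fun i => (i \in T1') + (i \in T2'))%N.
  by rewrite !cardE cU cI.
rewrite /sym_monom [RHS](reindex_inj (mulgI (s^-1)%g)) /=.
apply: eq_bigr => t _; rewrite (expE T1 T2 (a \o t)).
rewrite (expE T1' T2' (a \o (s^-1 * t)%g)) [RHS](reindex_perm s) /=.
by apply: eq_bigr => i _; rewrite permM permK sE.
Qed.

End SymmetrizedMonomials.

(** Double counting of the sum over t of [elem_sym (a \o t)]. It is stated without division so that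
    it also applies to polynomial-valued vectors, as in [sum_inj_outside]. *)
Lemma sum_perm_prod_mulrn (F : comNzRingType) (d : nat) (Q : {set 'I_d})
    (a : 'I_d -> F) :
  (\sum_(t : 'S_d) \prod_(i in Q) a (t i)) *+ 'C(d, #|Q|) =
  elem_sym a #|Q| *+ d`!.
Proof.
have QE (Q' : {set 'I_d}) :
    \sum_(t : 'S_d) \prod_(i in Q') a (t i) = sym_monom Q' finset.set0 a.
  by apply: eq_bigr => t _; rewrite big_set0 mulr1.
transitivity (\sum_(t : 'S_d) elem_sym (a \o t) #|Q|); last first.
  under eq_bigr do rewrite elem_sym_perm.
  by rewrite sumr_const -(card_Sn d); congr (_ *+ _); apply: eq_card.
rewrite [RHS]exchange_big /= [RHS](eq_bigr (fun=> sym_monom Q finset.set0 a)).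
  rewrite sumr_const QE; congr (_ *+ _); rewrite -[d in 'C(d, _)]card_ord.
  by rewrite -card_draws; apply: eq_card => S; rewrite !inE.
move=> S /eqP cS; apply: etrans (QE S) _.
by apply: sym_monom_card; rewrite ?finset.setU0 ?finset.setI0.
Qed.

Lemma sum_perm_prod (F : numFieldType) (d : nat) (Q : {set 'I_d})
    (a : 'I_d -> F) :
  \sum_(t : 'S_d) \prod_(i in Q) a (t i) =
  d`!%:R / 'C(d, #|Q|)%:R * elem_sym a #|Q|.
Proof.
have CQ0 : 'C(d, #|Q|)%:R != 0 :> F.
  by rewrite pnatr_eq0 -lt0n bin_gt0 -[X in (_ <= X)%N]card_ord max_card.
apply: (mulfI CQ0); rewrite !mulrA [_ * d`!%:R]mulrC mulfK // !mulr_natl.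
exact: sum_perm_prod_mulrn.
Qed.

Lemma prodD_subset (R : comNzRingType) (I : finType) (S : {set I})
    (F G : I -> R) :
  \prod_(i in S) (F i + G i) =
  \sum_(T : {set I} | T \subset S)
     (\prod_(i in T) F i) * \prod_(i in S :\: T) G i.
Proof.
rewrite big_mkcond (eq_bigr (fun i => (if i \in S then F i else 0) +
  (if i \in S then G i else 1))); last by move=> i _; case: ifP; rewrite ?add0r.
rewrite prodD_set [RHS]big_mkcond; apply: eq_bigr => T _.
case: ifP => [/fintype.subsetP TS|/negbT/subsetPn[i iT iS]]; last first.
  by rewrite (bigD1 i) //= (negPf iS) !mul0r.
congr (_ * _); first by apply: eq_bigr => i /TS ->.
rewrite [LHS]big_mkcond [RHS]big_mkcond; apply: eq_bigr => i _.
by rewrite !inE; case: (i \in T); case: (i \in S).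
Qed.

(** * Forms in the differences a i - a (s i) and their uniqueness *)

Definition ords (d n : nat) : {set 'I_d} := finset (fun i : 'I_d => (i < n)%N).

Lemma card_ords (d n : nat) : (n <= d)%N -> #|ords d n| = n.
Proof.
move=> lend; rewrite -sum1_card (eq_bigl (fun i : 'I_d => (i < n)%N)).
  by rewrite -(big_ord_widen d (fun=> 1%N) lend) sum1_card card_ord.
by move=> i; rewrite inE.
Qed.

Lemma natr_ffact (F : nzRingType) (n s : nat) :
  (n ^_ s)%:R = \prod_(j < s) (n%:R - j%:R) :> F.
Proof.
elim: s => [|s IHs]; first by rewrite big_ord0.
rewrite big_ord_recr /= -IHs ffactnSr natrM.
have [lesn|ltns] := leqP s n; first by rewrite natrB.
by rewrite ffact_small // !mul0r.
Qed.

Section DifferenceForms.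
Variables (F : numFieldType) (d k : nat).
Hypothesis lekd : (k <= d)%N.
Implicit Types (a : 'I_d -> F) (c : 'S_d -> {set 'I_d} -> F).

(** If A is diagonal with entries a, the commutator A H - H A has entries (a i - a j) H i j, so the
    coefficients of its characteristic polynomial have this shape in a. *)
Definition diff_form c a : F :=
  \sum_(s : 'S_d) \sum_(S : {set 'I_d} | #|S| == k)
     c s S * \prod_(i in S) (a i - a (s i)).

(** Nested prefixes represent the class of union size s and intersection size k - s. *)
Let monom s a := sym_monom (ords d s) (ords d (k - s)) a.

(** Span of the symmetrized monomials in at least k/2 and at most k variables. The weight is a total
    function vanishing outside this range, so that all sums share the index set s <= d. *)
Let kspan (f : ('I_d -> F) -> F) := exists2 w : nat -> F,
  forall s, ~~ (uphalf k <= s <= k)%N -> w s = 0 &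
  forall a, f a = \sum_(s < d.+1) w s * monom s a.

Local Lemma kspan_eq f g : f =1 g -> kspan f -> kspan g.
Proof. by move=> fg [w w0 wE]; exists w => // a; rewrite -fg. Qed.

Local Lemma kspan_sum (I : finType) (Q : pred I) f :
  (forall i, Q i -> kspan (f i)) -> kspan (fun a => \sum_(i | Q i) f i a).
Proof.
move=> Qf; suff : forall r, kspan (fun a => \sum_(i <- r | Q i) f i a) by apply.
elim=> [|i r [w w0 wE]].
  exists (fun=> 0) => // a; rewrite big_nil big1 // => s _; exact: mul0r.
case Qi: (Q i); last by exists w => // a; rewrite big_cons Qi.
have [w' w'0 w'E] := Qf i Qi.
exists (fun s => w' s + w s) => [s hs|a]; first by rewrite w0 // w'0 ?addr0.
by rewrite big_cons Qi wE w'E -big_split; apply: eq_bigr => s _; rewrite mulrDl.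
Qed.

Local Lemma kspanZ x f : kspan f -> kspan (fun a => x * f a).
Proof.
case=> w w0 wE; exists (fun s => x * w s) => [s /w0 ->|a]; first by rewrite mulr0.
by rewrite wE mulr_sumr; apply: eq_bigr => s _; rewrite mulrA.
Qed.

Local Lemma kspan_sym_monom (T1 T2 : {set 'I_d}) :
  (#|T1| + #|T2| = k)%N -> kspan (sym_monom T1 T2).
Proof.
move=> cT; set s := #|T1 :|: T2|.
have sUI := cardsUI T1 T2; rewrite cT -/s in sUI.
have leIs : (#|T1 :&: T2| <= s)%N.
  by apply/subset_leq_card/fintype.subsetP => i; rewrite !inE => /andP[->].
have lesd : (s <= d)%N by rewrite -[X in (_ <= X)%N]card_ord max_card.
exists (fun t => (t == s)%:R) => [t|a].
  by case: eqP => // ->; move: leIs sUI; clear; move: #|T1 :&: T2| s => x y; lia.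
rewrite (bigD1 (Ordinal (lesd : (s < d.+1)%N))) //= eqxx mul1r big1 ?addr0.
  apply: sym_monom_card.
    have -> : ords d s :|: ords d (k - s) = ords d s; last by rewrite card_ords.
    apply/setP=> i; rewrite !inE; apply/orb_idr => /leq_trans; apply.
    by move: leIs sUI; move: #|T1 :&: T2| => x; lia.
  have -> : ords d s :&: ords d (k - s) = ords d (k - s).
    apply/setP=> i; rewrite !inE; apply/andb_idl => /leq_trans; apply.
    by move: leIs sUI; move: #|T1 :&: T2| => x; lia.
  rewrite card_ords; last by lia.
  by move: sUI; move: #|T1 :&: T2| => x; lia.
move=> t; rewrite -val_eqE /= => /negPf ->; exact: mul0r.
Qed.

Local Lemma kspan_diff_form c :
  kspan (fun a => \sum_(t : 'S_d) diff_form c (a \o t)).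
Proof.
(* Expand each product by the set T of indices that contribute a i; the others contribute - a (s i),
   and s maps them injectively, so the two index sets have sizes adding up to k. *)
apply: (@kspan_eq (fun a => \sum_(s : 'S_d) \sum_(S : {set 'I_d} | #|S| == k)
  c s S * \sum_(T : {set 'I_d} | T \subset S)
    (-1) ^+ #|S :\: T| * sym_monom T [set s i | i in S :\: T] a)).
  move=> a; rewrite /diff_form [RHS]exchange_big; apply: eq_bigr => s _ /=.
  rewrite [RHS]exchange_big; apply: eq_bigr => S _ /=.
  rewrite -mulr_sumr; congr (_ * _).
  under [RHS]eq_bigr do rewrite prodD_subset.
  rewrite [RHS]exchange_big; apply: eq_bigr => T _ /=.
  rewrite mulr_sumr; apply: eq_bigr => t _.
  rewrite prodrN mulrCA; congr (_ * (_ * _)).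
  by rewrite big_imset //=; move=> i j _ _; exact: perm_inj.
apply: kspan_sum => s _; apply: kspan_sum => S /eqP cS; apply: kspanZ.
apply: kspan_sum => T TS; apply: kspanZ; apply: kspan_sym_monom.
rewrite card_imset; last exact: perm_inj.
by rewrite cardsDS // subnKC // subset_leq_card.
Qed.

Local Lemma monom_prefix01 (n s : nat) : (n <= d)%N -> (uphalf k <= s <= k)%N ->
  monom s (@prefix01 F d n) = (d - s)`!%:R * (n ^_ s)%:R.
Proof.
move=> lend /andP[hs hsk]; have lesd : (s <= d)%N := leq_trans hsk lekd.
(* On a 0/1 vector squares drop out, so the product over the smaller prefix is absorbed by the one
   over the larger. *)
transitivity (\sum_(t : 'S_d) \prod_(i in ords d s) @prefix01 F d n (t i)).
  apply: eq_bigr => t _.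
  rewrite [X in X * _](bigID (mem (ords d (k - s)))) /=.
  rewrite [RHS](bigID (mem (ords d (k - s)))) /= mulrAC; congr (_ * _).
  rewrite (eq_bigl (mem (ords d (k - s)))) -?big_split /=; last first.
    move=> i; rewrite !inE; apply/andb_idl => /leq_trans; apply; lia.
  by apply: eq_bigr => i _; rewrite /prefix01 -natrM mulnb andbb.
rewrite sum_perm_prod card_ords // elem_sym_prefix01 //.
rewrite -bin_ffact -(bin_fact lesd) !natrM.
have C0 : 'C(d, s)%:R != 0 :> F by rewrite pnatr_eq0 -lt0n bin_gt0.
by field.
Qed.

Local Lemma diff_form_compl c a :
  diff_form c (fun i => 1 - a i) = (-1) ^+ k * diff_form c a.
Proof.
rewrite mulr_sumr; apply: eq_bigr => s _.
rewrite mulr_sumr; apply: eq_bigr => S /eqP cS.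
rewrite mulrCA -cS -prodrN; congr (_ * _); apply: eq_bigr => i _.
by ring.
Qed.

(* A symmetric difference form is determined by its values on the vectors
   [prefix01 n], where it is a polynomial in n of degree at most k; this
   polynomial vanishes at n < k/2 since every monomial involves at least k/2
   variables, and at n > d - k/2 by the symmetry a <-> 1 - a. *)
Lemma diff_form_eq0 c :
  (forall a (t : 'S_d), diff_form c (a \o t) = diff_form c a) ->
  (~~ odd k -> diff_form c (@prefix01 F d k./2) = 0) ->
  forall a, diff_form c a = 0.
Proof.
move=> csym c0; have [w w0 wE] := kspan_diff_form c.
have d0 : d`!%:R != 0 :> F by rewrite pnatr_eq0 -lt0n fact_gt0.
have fE a : d`!%:R * diff_form c a = \sum_(s < d.+1) w s * monom s a.
  rewrite -wE (eq_bigr (fun=> diff_form c a)) //.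
  by rewrite sumr_const -(card_Sn d) mulr_natl; congr (_ *+ _); apply: eq_card.
pose v s := w s * (d - s)`!%:R.
have fpre n : (n <= d)%N ->
    d`!%:R * diff_form c (@prefix01 F d n) = \sum_(s < d.+1) v s * (n ^_ s)%:R.
  move=> lend; rewrite fE; apply: eq_bigr => s _.
  have [hs|/w0 w0s] := boolP (uphalf k <= s <= k)%N.
    by rewrite monom_prefix01 // mulrA.
  by rewrite /v w0s !mul0r.
pose G : {poly F} := \sum_(s < d.+1) v s *: \prod_(j < s) ('X - (j%:R)%:P).
have GE n : G.[n%:R] = \sum_(s < d.+1) v s * (n ^_ s)%:R.
  rewrite horner_sum; apply: eq_bigr => s _; rewrite hornerZ natr_ffact.
  by rewrite horner_prod; congr (_ * _); apply: eq_bigr => j _; rewrite !hornerE.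
have sG : (size G <= k.+1)%N.
  apply: (leq_trans (size_sum _ _ _)); apply/bigmax_leqP => s _.
  have [hs|/w0 w0s] := boolP (uphalf k <= s <= k)%N; last first.
    by rewrite /v w0s mul0r scale0r size_poly0.
  apply: (leq_trans (size_scale_leq _ _)).
  rewrite -(big_mkord xpredT (fun j => 'X - (j%:R)%:P)) size_prod_XsubC.
  by rewrite size_iota; lia.
have f0 n : (n < uphalf k)%N -> diff_form c (@prefix01 F d n) = 0.
  move=> hn; apply: (mulfI d0); rewrite mulr0 fpre; last by lia.
  apply: big1 => s _; have [hs|/w0 w0s] := boolP (uphalf k <= s <= k)%N.
    by rewrite ffact_small ?mulr0 //; lia.
  by rewrite /v w0s !mul0r.
have fC n : (n <= d)%N -> diff_form c (@prefix01 F d n) = 0 ->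
    diff_form c (@prefix01 F d (d - n)) = 0.
  (* Reversing the indices and complementing turns [prefix01 (d - n)] into [prefix01 n]. *)
  move=> lend n0; rewrite -(csym _ (perm (@rev_ord_inj d))).
  rewrite -[LHS]mul1r -(signrMK k 1) mulr1 -mulrA -diff_form_compl.
  suff -> : (fun i => 1 - (@prefix01 F d (d - n) \o perm (@rev_ord_inj d)) i) =
      @prefix01 F d n by rewrite n0 mulr0.
  apply/boolp.funext => i; rewrite /prefix01 /= permE /=.
  have -> : (d - i.+1 < d - n)%N = ~~ (i < n)%N.
    by have := ltn_ord i; case: ltnP; lia.
  by case: (i < n)%N; rewrite ?subr0 ?subrr.
have G0 : G = 0.
  (* The k + 1 roots: n <= k/2 and the last k - k/2 values up to d. For odd k the low block is
     exactly n < [uphalf k]; for even k it also contains n = k/2, where the hypothesis [c0]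
     enters. *)
  pose rs := [seq (i%:R : F) | i <- iota 0 k./2.+1 ++ iota (d - k + k./2.+1) (k - k./2)].
  apply/eqP; apply: contraT => nG0.
  have := @max_poly_roots _ G rs nG0; rewrite size_map size_cat !size_iota.
  have -> : (k./2.+1 + (k - k./2) = k.+1)%N by lia.
  move=> H; suff : (k.+1 < size G)%N by rewrite ltnNge sG.
  apply: H; last first.
    rewrite map_inj_uniq; last by move=> x y /eqP; rewrite eqr_nat => /eqP.
    rewrite cat_uniq !iota_uniq andbT andTb.
    apply/hasPn => x; rewrite !mem_iota; lia.
  apply/allP => _ /mapP[n + ->]; rewrite mem_cat !mem_iota => hn.
  have lend : (n <= d)%N by lia.
  rewrite /root GE -fpre //.
  suff -> : diff_form c (@prefix01 F d n) = 0 by rewrite mulr0.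
  have [hn'|hn'] := ltnP n (uphalf k); first exact: f0.
  have [hn''|hn''] := ltnP (d - n) (uphalf k).
    by have := fC (d - n)%N (leq_subr _ _) (f0 _ hn''); rewrite subKn.
  have -> : n = k./2 by lia.
  by apply: c0; lia.
(* Triangularity: n ^_ t vanishes for n < t, so evaluation at n = s isolates [v s] once the smaller
   weights are known to be 0. *)
have v0 s : (s <= d)%N -> v s = 0.
  elim/ltn_ind: s => s IHs lesd.
  have := GE s; rewrite G0 horner0 => /esym.
  rewrite (bigD1 (Ordinal (lesd : (s < d.+1)%N))) //= big1 ?addr0.
    by move/eqP; rewrite mulf_eq0 pnatr_eq0 ffactnn (gtn_eqF (fact_gt0 _)) orbF => /eqP.
  move=> t; rewrite -val_eqE /= => nts.
  have [lts|lest] := ltnP t s; last by rewrite ffact_small ?mulr0 //; lia.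
  by rewrite IHs ?mul0r //; lia.
move=> a; apply: (mulfI d0); rewrite mulr0 fE big1 // => s _.
have := v0 s (ltn_ord s : (s <= d)%N) => /eqP.
by rewrite mulf_eq0 pnatr_eq0 (gtn_eqF (fact_gt0 _)) orbF => /eqP ->; rewrite mul0r.
Qed.

End DifferenceForms.

(** * The explicit symmetric difference form *)

Section SymmetricDifference.
Variables (F : numFieldType) (d k : nat).
Hypothesis lekd : (k <= d)%N.
Implicit Types (a : 'I_d -> F) (c : 'S_d -> {set 'I_d} -> F).

(** Average over all permutations s of the k-th elementary symmetric function of the differences a i
    - a (s i). It is visibly a difference form, and [sym_diffE] identifies it with the sum in the
    theorem. *)
Definition sym_diff a : F := diff_form k (fun _ _ => (d`!%:R)^-1) a.

(** Complementation turns these sets into the subsets of [~: Q] with d - k elements. *)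
Lemma card_supersets (Q : {set 'I_d}) :
  #|[pred S : {set 'I_d} | (#|S| == k) && (Q \subset S)]| =
  'C(d - #|Q|, d - k).
Proof.
have -> : (d - #|Q| = #|~: Q|)%N.
  by rewrite -[X in (X - _)%N](card_ord d) -(cardsC Q) addKn.
rewrite -cards_draws -(card_imset _ (@finset.setC_inj _)).
apply: eq_card => S; rewrite !inE.
apply/andP/imsetP => [[/eqP cS QS]|[S' + ->]].
  exists (~: S); rewrite ?finset.setCK // inE finset.setCS QS /=.
  by have := cardsC S; rewrite card_ord cS; move: #|~: S| => x; lia.
rewrite inE => /andP[S'Q /eqP cS']; split.
  by have := cardsC S'; rewrite card_ord cS'; move: #|~: S'| => x; lia.
by rewrite -finset.setCS finset.setCK.
Qed.

Lemma sym_diffE a :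
  sym_diff a = \sum_(i < k.+1) (-1) ^+ i *
     (((d - i)`! * (d - (k - i))`!)%:R / (d`! * (d - k)`!)%:R) *
     elem_sym a i * elem_sym a (k - i).
Proof.
(* Total contribution of the choice of a i exactly on Q: the sum over s turns the remaining k - #|Q|
   factors into a multiple of an elementary symmetric function, and the last binomial counts the
   sets S containing Q. *)
pose X (Q : {set 'I_d}) : F := (-1) ^+ (k - #|Q|) * elem_sym a (k - #|Q|) /
  'C(d, k - #|Q|)%:R * (\prod_(i in Q) a i) * 'C(d - #|Q|, d - k)%:R.
have d0 n : n`!%:R != 0 :> F by rewrite pnatr_eq0 -lt0n fact_gt0.
transitivity (\sum_(Q : {set 'I_d}) X Q).
  rewrite /sym_diff /diff_form exchange_big /=.
  transitivity (\sum_(S : {set 'I_d} | #|S| == k)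
    \sum_(Q : {set 'I_d} | Q \subset S) (-1) ^+ (k - #|Q|) *
      elem_sym a (k - #|Q|) / 'C(d, k - #|Q|)%:R * (\prod_(i in Q) a i)).
    apply: eq_bigr => S /eqP cS; rewrite -mulr_sumr.
    under eq_bigr do rewrite prodD_subset.
    rewrite exchange_big mulr_sumr; apply: eq_bigr => Q QS /=.
    under eq_bigr do rewrite prodrN mulrCA.
    rewrite -mulr_sumr -mulr_sumr sum_perm_prod cardsDS // cS.
    move: (d0 d) ((-1) ^+ _) (\prod_(i in Q) a i) ('C(_, _)%:R^-1) (elem_sym _ _).
    by move: d`!%:R => x x0 u v w z; field.
  rewrite (exchange_big_dep xpredT) //=; apply: eq_bigr => Q _.
  by rewrite sumr_const card_supersets /X mulr_natr.
(* Sort the sets Q by i = k - #|Q|; those with more than k elements have no such i, but for them the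
   counting binomial is 0. *)
transitivity (\sum_(Q : {set 'I_d}) \sum_(i < k.+1 | #|Q| == (k - i)%N) X Q).
  apply: eq_bigr => Q _; have [leQk|ltkQ] := leqP #|Q| k.
    rewrite (big_pred1 (inord (k - #|Q|))) // => i; rewrite /= -val_eqE /=.
    rewrite inordK ?ltnS ?leq_subr //.
    by have := ltn_ord i; move: leQk; move: #|Q| => x; lia.
  have lQ : (#|Q| <= d)%N by rewrite -[X in (_ <= X)%N]card_ord max_card.
  have X0 : X Q = 0.
    by rewrite /X (@bin_small (d - #|Q|)) ?mulr0 //; move: ltkQ lQ lekd; move: #|Q| => x; lia.
  by rewrite X0 big1.
rewrite (exchange_big_dep xpredT) //=; apply: eq_bigr => i _ /=.
rewrite /elem_sym -/(elem_sym a i) mulr_sumr; apply: eq_bigr => Q /eqP cQ.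
have leik : (i <= k)%N by rewrite -ltnS.
rewrite /X cQ subKn //.
have -> : 'C(d - (k - i), d - k)%:R = (d - (k - i))`!%:R / ((d - k)`! * i`!)%:R :> F.
  have le1 : (d - k <= d - (k - i))%N by lia.
  rewrite -(bin_fact le1) (_ : d - (k - i) - (d - k) = i)%N; last by lia.
  by rewrite natrM mulfK // natrM mulf_neq0.
have leid : (i <= d)%N by apply: leq_trans lekd.
have C0 : 'C(d, i)%:R != 0 :> F by rewrite pnatr_eq0 -lt0n bin_gt0.
rewrite -[in RHS](bin_fact leid) !natrM; field.
by rewrite !d0 C0.
Qed.

Lemma sym_diff_perm a (t : 'S_d) : sym_diff (a \o t) = sym_diff a.
Proof.
by rewrite !sym_diffE; apply: eq_bigr => i _; rewrite !elem_sym_perm.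
Qed.

Lemma sym_diff_prefix01 m : k = m.*2 ->
  sym_diff (@prefix01 F d m) =
  (-1) ^+ m * ((d - m)`! ^ 2)%:R / (d`! * (d - k)`!)%:R.
Proof.
move=> km; rewrite sym_diffE; have ltmk : (m < k.+1)%N by lia.
(* 'C(m, i) * 'C(m, 2m - i) vanishes unless i = m. *)
rewrite (bigD1 (Ordinal ltmk)) //= [X in _ + X]big1 ?addr0 => [|i].
  rewrite !elem_sym_prefix01; try lia.
  rewrite (_ : k - m = m)%N; last by lia.
  by rewrite binn !mulr1 mulnn mulrA.
rewrite -val_eqE /= => nim; rewrite !elem_sym_prefix01; try lia; last first.
  by have := ltn_ord i; lia.
have [ltmi|leim] := ltnP m i; first by rewrite bin_small ?mulr0 ?mul0r.
by rewrite [X in _ * X%:R](@bin_small m) ?mulr0 //; lia.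
Qed.

(** The combination [c'] is built to vanish at [prefix01 m], hence vanishes everywhere by
    [diff_form_eq0]. Proportionality is stated in cross-multiplied form, which needs no division. *)
Lemma diff_form_even c m : k = m.*2 ->
  (forall a (t : 'S_d), diff_form k c (a \o t) = diff_form k c a) ->
  forall a, sym_diff (@prefix01 F d m) * diff_form k c a =
            sym_diff a * diff_form k c (@prefix01 F d m).
Proof.
move=> km csym a.
pose x := sym_diff (@prefix01 F d m); pose y := diff_form k c (@prefix01 F d m).
pose c' (s : 'S_d) (S : {set 'I_d}) := x * c s S - y * (d`!%:R)^-1.
have c'E b : diff_form k c' b = x * diff_form k c b - y * sym_diff b.
  rewrite !mulr_sumr -sumrB; apply: eq_bigr => s _.
  rewrite !mulr_sumr -sumrB; apply: eq_bigr => S _.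
  by rewrite /c' mulrBl !mulrA.
have : diff_form k c' a = 0.
  apply: diff_form_eq0 => // [b t|_]; first by rewrite !c'E csym sym_diff_perm.
  by rewrite (_ : k./2 = m) ?c'E -/x -/y; [rewrite mulrC subrr | lia].
by rewrite c'E => /eqP; rewrite subr_eq0 [y * _]mulrC => /eqP.
Qed.

End SymmetricDifference.

(** * Coefficients of the characteristic polynomial *)

Section CharPoly.
Variable F : numFieldType.

Lemma scoef_prod_XsubC (d k : nat) (a : 'I_d -> F) : (k <= d)%N ->
  scoef d (\prod_i ('X - (a i)%:P)) k = elem_sym a k.
Proof.
move=> lekd; rewrite /scoef.
under eq_bigr do rewrite -polyCN.
rewrite -elem_sym_coef // mulr_sumr; apply: eq_bigr => S /eqP cS.
by rewrite prodrN cS signrMK.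
Qed.

(** Leibniz expansion of det (x I - X), where S is the set of rows in which x is not chosen. It
    exhibits the coefficient as a polynomial in the entries and, for a commutator with a diagonal
    matrix, as a difference form. *)
Lemma scoef_char_poly (d k : nat) (X : 'M[F]_d) : (k <= d)%N ->
  scoef d (char_poly X) k =
  \sum_(s : 'S_d) \sum_(S : {set 'I_d} | #|S| == k)
     (-1) ^+ s * (\prod_(i in ~: S) (i == s i)%:R) * \prod_(i in S) X i (s i).
Proof.
move=> lekd; rewrite /scoef /char_poly /determinant coef_sum mulr_sumr.
apply: eq_bigr => s _.
rewrite (eq_bigr (fun i => (i == s i)%:R *: 'X + (- X i (s i))%:P)); last first.
  by move=> i _; rewrite !mxE polyCN scaler_nat.
have -> : forall (b : bool) (p : {poly F}) j, ((-1) ^+ b * p)`_j = (-1) ^+ b * p`_j.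
  by move=> b p j; rewrite !mulr_sign; case: b; rewrite ?coefN.
rewrite coef_prod_affine // !mulr_sumr; apply: eq_bigr => S /eqP cS.
rewrite prodrN cS mulrCA -!mulrA signrMK; congr (_ * _); exact: mulrC.
Qed.

Lemma char_poly_conj (d : nat) (V W X : 'M[F]_d) :
  V *m W = 1%:M -> char_poly (V *m X *m W) = char_poly X.
Proof.
move=> VW; rewrite /char_poly /char_poly_mx.
have VWp : map_mx polyC V *m map_mx polyC W = 1%:M.
  by rewrite -map_mxM VW map_mx1.
rewrite !map_mxM /=.
have -> : 'X%:M - map_mx polyC V *m map_mx polyC X *m map_mx polyC W =
    map_mx polyC V *m ('X%:M - map_mx polyC X) *m map_mx polyC W.
  by rewrite mulmxBr mulmxBl scalar_mxC -(mulmxA 'X%:M) VWp mulmx1.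
by rewrite !det_mulmx mulrAC -det_mulmx VWp det1 mul1r.
Qed.

End CharPoly.

Lemma elemsym_scoef (C : numClosedFieldType) (d k : nat) (X : 'M[C]_d) :
  (k <= d)%N -> elemsym k X = scoef d (char_poly X) k.
Proof.
move=> lekd; rewrite /elemsym /eigenvalues; case: closed_field_poly_normal => r /=.
rewrite (monicP (char_poly_monic X)) scale1r => cE.
have sr : size r = d.
  by have := size_char_poly X; rewrite cE size_prod_XsubC => -[].
rewrite cE (big_nth 0) sr big_mkord.
by rewrite (scoef_prod_XsubC (fun i => r`_i)).
Qed.

(** * Polynomial functions of a matrix: measurability and boundedness *)

Lemma mulmx_continuous (K : numFieldType) (m n p : nat) (V : 'M[K]_(m, n)) :
  continuous (fun N : 'M[K]_(n, p) => V *m N).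
Proof.
move=> M A [Q MQ QA].
(* A neighbourhood of a matrix is a finite family of neighbourhoods of its entries, so continuity
   may be checked entry by entry. *)
suff : \forall N \near M, forall i j, Q i j ((V *m N) i j).
  by apply: filterS => N /QA.
have FM : Filter (nbhs M) by exact: nbhs_filter.
apply: (@filter_forall _ _ _ _ FM) => i; apply: (@filter_forall _ _ _ _ FM) => j.
have cf (r : seq 'I_n) :
    continuous (fun N : 'M[K]_(n, p) => \sum_(k <- r) V i k * N k j).
  elim: r => [|k r IHr] N.
    by under boolp.eq_fun do rewrite big_nil; exact: cst_continuous.
  under boolp.eq_fun do rewrite big_cons.
  apply: (@continuousD _ _ _ _ _ N); last exact: IHr.
  apply: (@continuousM _ _ _ _ N); first exact: cst_continuous.
  exact: coord_continuous.
have := MQ i j; rewrite mxE => /(cf _ M); apply: (@filterS _ (nbhs M) FM) => N.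
by rewrite /= mxE.
Qed.

Section PolynomialFunctions.
Local Open Scope classical_set_scope.
Local Open Scope complex_scope.
Local Open Scope sesquilinear_scope.
Variables (R : realType) (d : nat).
Local Notation C := R[i].
Local Notation Mx := 'M[C]_d.

(** Polynomials in the entries and their conjugates. Induction on this predicate gives measurability
    and a bound on the unitary group, hence integrability of every integrand below. *)
Inductive polyfun : (Mx -> C) -> Prop :=
  | polyfun_cst c : polyfun (fun=> c)
  | polyfun_entry i j : polyfun (fun X => X i j)
  | polyfun_conj_entry i j : polyfun (fun X => (X i j)^*%R)
  | polyfunD f g : polyfun f -> polyfun g -> polyfun (fun X => f X + g X)
  | polyfunM f g : polyfun f -> polyfun g -> polyfun (fun X => f X * g X).

Lemma polyfun_conj f : polyfun f -> polyfun (fun X => (f X)^*%R).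
Proof.
elim=> [c|i j|i j|g h _ IHg _ IHh|g h _ IHg _ IHh].
- exact: polyfun_cst.
- exact: polyfun_conj_entry.
- by under boolp.eq_fun do rewrite conjCK; exact: polyfun_entry.
- by under boolp.eq_fun do rewrite rmorphD; exact: polyfunD.
- by under boolp.eq_fun do rewrite rmorphM; exact: polyfunM.
Qed.

Lemma polyfunB f g : polyfun f -> polyfun g -> polyfun (fun X => f X - g X).
Proof.
move=> pf pg; under boolp.eq_fun do rewrite -mulN1r.
by apply: polyfunD => //; apply: polyfunM => //; exact: polyfun_cst.
Qed.

Lemma polyfun_sum (I : Type) (r : seq I) (Q : pred I) (f : I -> Mx -> C) :
  (forall i, polyfun (f i)) -> polyfun (fun X => \sum_(i <- r | Q i) f i X).
Proof.
move=> pf; elim: r => [|i r IHr].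
  by under boolp.eq_fun do rewrite big_nil; exact: polyfun_cst.
under boolp.eq_fun do rewrite big_cons.
by case: (Q i) => //; exact: polyfunD.
Qed.

Lemma polyfun_prod (I : Type) (r : seq I) (Q : pred I) (f : I -> Mx -> C) :
  (forall i, polyfun (f i)) -> polyfun (fun X => \prod_(i <- r | Q i) f i X).
Proof.
move=> pf; elim: r => [|i r IHr].
  by under boolp.eq_fun do rewrite big_nil; exact: polyfun_cst.
under boolp.eq_fun do rewrite big_cons.
by case: (Q i) => //; exact: polyfunM.
Qed.

Definition polymx m n (G : Mx -> 'M[C]_(m, n)) :=
  forall i j, polyfun (fun X => G X i j).

Lemma polymx_id : polymx (fun X => X).
Proof. exact: polyfun_entry. Qed.

Lemma polymx_cst m n (A : 'M[C]_(m, n)) : polymx (fun=> A).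
Proof. by move=> i j; exact: polyfun_cst. Qed.

Lemma polymx_mul m n p (G : Mx -> 'M[C]_(m, n)) (H : Mx -> 'M[C]_(n, p)) :
  polymx G -> polymx H -> polymx (fun X => G X *m H X).
Proof.
move=> pG pH i j; under boolp.eq_fun do rewrite mxE.
by apply: polyfun_sum => l; exact: polyfunM.
Qed.

Lemma polymxB m n (G H : Mx -> 'M[C]_(m, n)) :
  polymx G -> polymx H -> polymx (fun X => G X - H X).
Proof.
by move=> pG pH i j; under boolp.eq_fun do rewrite !mxE; exact: polyfunB.
Qed.

Lemma polymx_trC m n (G : Mx -> 'M[C]_(m, n)) :
  polymx G -> polymx (fun X => (G X)^t*).
Proof.
by move=> pG i j; under boolp.eq_fun do rewrite !mxE; exact: polyfun_conj.
Qed.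

Lemma polyfun_det n (G : Mx -> 'M[C]_n) : polymx G -> polyfun (fun X => \det (G X)).
Proof.
move=> pG; apply: polyfun_sum => s; apply: polyfunM; first exact: polyfun_cst.
by apply: polyfun_prod => i; exact: pG.
Qed.

Lemma polyfun_comp f (G : Mx -> Mx) :
  polyfun f -> polymx G -> polyfun (fun X => f (G X)).
Proof.
move=> + pG; elim=> [c|i j|i j|g h _ IHg _ IHh|g h _ IHg _ IHh].
- exact: polyfun_cst.
- exact: pG.
- exact: polyfun_conj.
- exact: polyfunD.
- exact: polyfunM.
Qed.

Lemma polyfun_scoef_char_poly k : (k <= d)%N ->
  polyfun (fun X => scoef d (char_poly X) k).
Proof.
move=> lekd; under boolp.eq_fun do rewrite scoef_char_poly //.
apply: polyfun_sum => s; apply: polyfun_sum => S.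
apply: polyfunM; first exact: polyfun_cst.
by apply: polyfun_prod => i; exact: polyfun_entry.
Qed.

(** Finite sums of products f(X) g(Y). Iterated expectations of these can be exchanged by linearity
    alone, without a product measure. *)
Inductive sepfun : (Mx -> Mx -> C) -> Prop :=
  | sepfun_mul f g : polyfun f -> polyfun g -> sepfun (fun X Y => f X * g Y)
  | sepfunD F G : sepfun F -> sepfun G -> sepfun (fun X Y => F X Y + G X Y).

Lemma sepfunM F G : sepfun F -> sepfun G -> sepfun (fun X Y => F X Y * G X Y).
Proof.
move=> + sG; elim=> [f g pf pg|F1 F2 _ IH1 _ IH2]; last first.
  by under boolp.eq2_fun do rewrite mulrDl; exact: sepfunD.
elim: sG => [f' g' pf' pg'|G1 G2 _ IH1 _ IH2]; last first.
  by under boolp.eq2_fun do rewrite mulrDr; exact: sepfunD.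
by under boolp.eq2_fun do rewrite mulrACA; apply: sepfun_mul; exact: polyfunM.
Qed.

Lemma sepfun_sum (I : Type) (r : seq I) (F : I -> Mx -> Mx -> C) :
  (forall i, sepfun (F i)) -> sepfun (fun X Y => \sum_(i <- r) F i X Y).
Proof.
move=> sF; elim: r => [|i r IHr].
  under boolp.eq2_fun do rewrite big_nil.
  have := sepfun_mul (polyfun_cst 0) (polyfun_cst 0).
  by under boolp.eq2_fun do rewrite mulr0.
by under boolp.eq2_fun do rewrite big_cons; exact: sepfunD.
Qed.

Lemma sepfun_trC_mul f : polyfun f -> sepfun (fun X Y => f (X^t* *m Y)).
Proof.
elim=> [c|i j|i j|g h _ IHg _ IHh|g h _ IHg _ IHh].
- have := sepfun_mul (polyfun_cst c) (polyfun_cst 1).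
  by under boolp.eq2_fun do rewrite mulr1.
- under boolp.eq2_fun do rewrite mxE; apply: sepfun_sum => l.
  under boolp.eq2_fun do rewrite !mxE.
  exact: (sepfun_mul (polyfun_conj_entry _ _) (polyfun_entry _ _)).
- under boolp.eq2_fun do rewrite mxE rmorph_sum; apply: sepfun_sum => l.
  under boolp.eq2_fun do rewrite !mxE rmorphM /= conjCK.
  exact: (sepfun_mul (polyfun_entry _ _) (polyfun_conj_entry _ _)).
- exact: sepfunD.
- exact: sepfunM.
Qed.

Local Notation Bx := (borelMx R d).

Lemma norm_Re_le (x : C) : `|complex.Re x|%:C <= `|x|.
Proof. exact: normc_ge_Re. Qed.

Lemma norm_Im_le (x : C) : `|complex.Im x|%:C <= `|x|.
Proof.
have := normc_ge_Re (x * 'i%C); rewrite ReiNIm normrN normrM.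
by rewrite [`|'i%C|]normc_def /= expr0n expr1n add0r sqrtr1 mulr1.
Qed.

Lemma open_measurable_borelMx (A : set 'M[C^o]_d) : open A -> measurable (A : set Bx).
Proof. by move=> oA; apply: sub_sigma_algebra. Qed.

(** [h] stands for the real or the imaginary part: an additive map dominated by the modulus is
    continuous, so preimages of open intervals are open. *)
Lemma measurable_entry (h : {additive C -> R}) i j :
  (forall x, `|h x|%:C <= `|x|) ->
  measurable_fun [set: Bx] (fun X : Bx => h ((X : Mx) i j)).
Proof.
move=> hle.
apply: (measurability _ (RGenOpens.measurableE R)) => //.
move=> _ [_ [x [y ->] <-]]; rewrite setTI.
apply: open_measurable_borelMx; rewrite openE => M /= BM.
have := @interval_open R (BRight x) (BLeft y) isT isT.
rewrite openE => /(_ _ BM) /nbhs_ballP[e e0 eB].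
apply/nbhs_ballP; exists e%:C => /=; first by rewrite ltcR.
move=> N [_ /(_ i j)] /=; rewrite -ball_normE /= => MN.
apply: eB; rewrite -ball_normE /= -raddfB -ltcR.
exact: le_lt_trans (hle _) MN.
Qed.

Lemma measurable_mulmx (V : Mx) : measurable_fun [set: Bx] (mulmx V : Bx -> Bx).
Proof.
apply: (@measurability _ _ Bx Bx _ _ (@open 'M[C^o]_d)) => //.
move=> _ [A oA <-]; rewrite setTI.
apply: open_measurable_borelMx; rewrite openE => M /= AM.
exact: (mulmx_continuous (K := C) (open_nbhs_nbhs (conj oA AM))).
Qed.

Lemma polyfun_measurable f : polyfun f ->
  measurable_fun [set: Bx] (fun X : Bx => complex.Re (f X)) /\
  measurable_fun [set: Bx] (fun X : Bx => complex.Im (f X)).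
Proof.
have mRe i j := @measurable_entry (@complex.Re R) i j norm_Re_le.
have mIm i j := @measurable_entry (@complex.Im R) i j norm_Im_le.
have ReD (x y : C) : complex.Re (x + y) = complex.Re x + complex.Re y.
  by case: x; case: y.
have ImD (x y : C) : complex.Im (x + y) = complex.Im x + complex.Im y.
  by case: x; case: y.
have ReM (x y : C) : complex.Re (x * y) =
    complex.Re x * complex.Re y - complex.Im x * complex.Im y.
  by case: x; case: y.
have ImM (x y : C) : complex.Im (x * y) =
    complex.Re x * complex.Im y + complex.Im x * complex.Re y.
  by case: x; case: y.
have ReJ (x : C) : complex.Re (x^*%R) = complex.Re x by case: x.
have ImJ (x : C) : complex.Im (x^*%R) = - complex.Im x by case: x.
elim=> [c|i j|i j|g h _ [g1 g2] _ [h1 h2]|g h _ [g1 g2] _ [h1 h2]].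
- by split; exact: measurable_cst.
- by split; [exact: mRe | exact: mIm].
- split; first by under boolp.eq_fun do rewrite ReJ; exact: mRe.
  under boolp.eq_fun do rewrite ImJ.
  exact: measurable_funN (mIm i j).
- split; first by under boolp.eq_fun do rewrite ReD; exact: measurable_funD.
  by under boolp.eq_fun do rewrite ImD; exact: measurable_funD.
- split; first by under boolp.eq_fun do rewrite ReM;
    apply: measurable_funB; exact: measurable_funM.
  by under boolp.eq_fun do rewrite ImM;
    apply: measurable_funD; exact: measurable_funM.
Qed.

Lemma norm_unitarymx_entry (X : Mx) i j : X \is unitarymx -> `|X i j| <= 1.
Proof.
move=> /unitarymxP /matrixP/(_ i i); rewrite !mxE eqxx mulr1n => XX.
rewrite -(@ler_pXn2r _ 2) ?nnegrE // expr1n -[leRHS]XX (bigD1 j) //= !mxE normCK.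
by rewrite lerDl sumr_ge0 // => k _; rewrite !mxE -normCK exprn_ge0.
Qed.

Lemma polyfun_bounded f : polyfun f ->
  exists M : C, forall X : Mx, X \is unitarymx -> `|f X| <= M.
Proof.
elim=> [c|i j|i j|g h _ [M1 H1] _ [M2 H2]|g h _ [M1 H1] _ [M2 H2]].
- by exists `|c|.
- by exists 1 => X; exact: norm_unitarymx_entry.
- by exists 1 => X; rewrite norm_conjC; exact: norm_unitarymx_entry.
- exists (M1 + M2) => X uX; apply: le_trans (ler_normD _ _) _.
  by rewrite lerD ?H1 ?H2.
- by exists (M1 * M2) => X uX; rewrite normrM ler_pM ?H1 ?H2.
Qed.

End PolynomialFunctions.

(** * Expectation of polynomial functions of a Haar unitary *)

Section HaarExpectation.
Local Open Scope classical_set_scope.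
Local Open Scope complex_scope.
Local Open Scope sesquilinear_scope.
Variables (R : realType) (disp : measure_display) (T : measurableType disp).
Variables (P : probability T R) (d : nat) (U : T -> 'M[R[i]]_d).
Hypothesis hU : haar_unitary P U.
Local Notation C := R[i].
Local Notation Mx := 'M[C]_d.
Local Notation Bx := (borelMx R d).

Let mU : measurable_fun [set: T] (U : T -> Bx). Proof. by case: hU. Qed.
Let uU t : U t \is unitarymx. Proof. by case: hU. Qed.

Definition EU (f : Mx -> C) : C := expectationC P (fun t => f (U t)).

Lemma EU_Rintegral f :
  EU f = (\int[P]_t complex.Re (f (U t)))%R +i* (\int[P]_t complex.Im (f (U t)))%R.
Proof. by rewrite /EU /expectationC unlock. Qed.

Lemma eq_EU f g : (forall X : Mx, X \is unitarymx -> f X = g X) -> EU f = EU g.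
Proof.
move=> fg; rewrite /EU; congr expectationC; apply/boolp.funext => t.
exact: fg (uU t).
Qed.

Lemma bounded_integrable_haar (g : Bx -> R) (M : R) :
  measurable_fun [set: Bx] g ->
  (forall X : Mx, X \is unitarymx -> `|g X| <= M) ->
  P.-integrable [set: T] (EFin \o (fun t => g (U t))).
Proof.
move=> mg gM; apply: measurable_bounded_integrable => //.
- by rewrite [X in (X < _)%E]probability_setT ltry.
- exact: (measurableT_comp mg mU).
- exists M; split; first exact: num_real.
  by move=> x Mx t _ /=; apply: le_trans (ltW Mx); exact: gM.
Qed.

Lemma polyfun_integrable f : polyfun f ->
  P.-integrable [set: T] (EFin \o (fun t => complex.Re (f (U t)))) /\
  P.-integrable [set: T] (EFin \o (fun t => complex.Im (f (U t)))).
Proof.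
move=> pf; have [mR mI] := polyfun_measurable pf.
have [M fM] := polyfun_bounded pf.
have fM' (h : C -> R) (X : Mx) : (forall x, `|h x|%:C <= `|x|) ->
    X \is unitarymx -> `|h (f X)| <= complex.Re M.
  move=> hle uX; have := le_trans (hle (f X)) (fM X uX).
  by rewrite lecE => /andP[].
split.
  apply: (@bounded_integrable_haar (fun X => complex.Re (f X)) (complex.Re M)) => //.
  by move=> X; apply: fM'; exact: norm_Re_le.
apply: (@bounded_integrable_haar (fun X => complex.Im (f X)) (complex.Re M)) => //.
by move=> X; apply: fM'; exact: norm_Im_le.
Qed.

Lemma EU_cst c : EU (fun=> c) = c.
Proof.
rewrite EU_Rintegral !Rintegral_cst //= probability_setT /= !mulr1.
by case: c.
Qed.

Lemma EUD f g : polyfun f -> polyfun g ->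
  EU (fun X => f X + g X) = EU f + EU g.
Proof.
move=> /polyfun_integrable[f1 f2] /polyfun_integrable[g1 g2].
rewrite !EU_Rintegral /= -[RHS]/(_ +i* _); congr (_ +i* _).
  rewrite -RintegralD //; apply: eq_Rintegral => t _.
  by case: (f _); case: (g _).
rewrite -RintegralD //; apply: eq_Rintegral => t _.
by case: (f _); case: (g _).
Qed.

Lemma EUZ c f : polyfun f -> EU (fun X => c * f X) = c * EU f.
Proof.
move=> /polyfun_integrable[f1 f2].
have Zint (x : R) (g : T -> R) : P.-integrable [set: T] (EFin \o g) ->
    P.-integrable [set: T] (EFin \o (fun t => x * g t)).
  by move=> ig; apply: (integrableZl measurableT x ig).
rewrite !EU_Rintegral; case: c => a b /=.
rewrite -[RHS]/(_ +i* _); congr (_ +i* _).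
  rewrite -!RintegralZl // -RintegralB //; [|exact: Zint..].
  by apply: eq_Rintegral => t _; case: (f _).
rewrite -!RintegralZl // -RintegralD //; [|exact: Zint..].
by apply: eq_Rintegral => t _; case: (f _).
Qed.

Lemma EUMr f c : polyfun f -> EU (fun X => f X * c) = EU f * c.
Proof. by move=> pf; under boolp.eq_fun do rewrite mulrC; rewrite EUZ // mulrC. Qed.

Lemma EU_sum (I : Type) (r : seq I) (Q : pred I) (f : I -> Mx -> C) :
  (forall i, polyfun (f i)) ->
  EU (fun X => \sum_(i <- r | Q i) f i X) = \sum_(i <- r | Q i) EU (f i).
Proof.
move=> pf; elim: r => [|i r IHr].
  by under boolp.eq_fun do rewrite big_nil; rewrite EU_cst big_nil.
rewrite big_cons -IHr; under boolp.eq_fun do rewrite big_cons.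
by case: (Q i) => //; rewrite EUD //; exact: polyfun_sum.
Qed.

Lemma Rintegral_mull (V : Mx) (g : Bx -> R) (M : R) : V \is unitarymx ->
  measurable_fun [set: Bx] g ->
  (forall X : Mx, X \is unitarymx -> `|g X| <= M) ->
  (\int[P]_t g (V *m U t) = \int[P]_t g (U t))%R.
Proof.
move=> uV mg gM; rewrite /Rintegral; congr fine.
have mVU : measurable_fun [set: T] ((fun t => V *m U t) : T -> Bx).
  exact: (measurableT_comp (measurable_mulmx V) mU).
have ig := bounded_integrable_haar mg gM.
have igV : P.-integrable [set: T] (EFin \o (fun t => g (V *m U t))).
  apply: (@bounded_integrable_haar (fun X => g (V *m X)) M).
    exact: (measurableT_comp mg (measurable_mulmx V)).
  by move=> X uX; apply: gM; exact: mul_unitarymx.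
have mEg : measurable_fun [set: Bx] (EFin \o g) by exact/measurable_EFinP.
(* Both sides become integrals of g on the space of matrices, against the laws of V U and of U,
   which agree on measurable sets by Haar invariance. *)
have := @integral_pushforward _ _ T Bx R _ mVU P setT _ mEg igV measurableT.
have := @integral_pushforward _ _ T Bx R _ mU P setT _ mEg ig measurableT.
rewrite !preimage_setT => <- <-.
apply: eq_measure_integral => A mA _.
by case: hU => _ _ /(_ V uV A mA).
Qed.

Lemma EU_mull V f : V \is unitarymx -> polyfun f ->
  EU (fun X => f (V *m X)) = EU f.
Proof.
move=> uV pf; have [mR mI] := polyfun_measurable pf.
have [M fM] := polyfun_bounded pf.
have fM' (h : C -> R) (X : Mx) : (forall x, `|h x|%:C <= `|x|) ->
    X \is unitarymx -> `|h (f X)| <= complex.Re M.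
  move=> hle uX; have := le_trans (hle (f X)) (fM X uX).
  by rewrite lecE => /andP[].
rewrite !EU_Rintegral; congr (_ +i* _).
  apply: (@Rintegral_mull V (fun X => complex.Re (f X)) (complex.Re M)) => //.
  by move=> X; apply: fM'; exact: norm_Re_le.
apply: (@Rintegral_mull V (fun X => complex.Im (f X)) (complex.Re M)) => //.
by move=> X; apply: fM'; exact: norm_Im_le.
Qed.

(** On a single product both iterated expectations equal [EU f * EU g]. The four [polyfun] clauses
    are carried along because additivity of [EU] is available only for such functions. *)
Lemma sepfun_EU_exchange F : sepfun F ->
  [/\ forall X, polyfun (F X), forall Y, polyfun (F^~ Y),
      polyfun (fun X => EU (F X)), polyfun (fun Y => EU (F^~ Y)) &
      EU (fun X => EU (F X)) = EU (fun Y => EU (F^~ Y))].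
Proof.
elim=> [f g pf pg|F1 F2 _ [a1 a2 a3 a4 a5] _ [b1 b2 b3 b4 b5]].
  have E1 X : EU (fun Y => f X * g Y) = f X * EU g by rewrite EUZ.
  have E2 Y : EU (fun X => f X * g Y) = EU f * g Y by rewrite EUMr.
  have pc c := @polyfun_cst R d c.
  split=> [X|Y|||]; first exact: (polyfunM (pc _) pg).
  - exact: (polyfunM pf (pc _)).
  - by under boolp.eq_fun do rewrite E1; exact: polyfunM.
  - by under boolp.eq_fun do rewrite E2; exact: polyfunM.
  under boolp.eq_fun do rewrite E1; rewrite EUMr //.
  by under [RHS]eq_EU do rewrite E2; rewrite EUZ.
have E1 X : EU (fun Y => F1 X Y + F2 X Y) = EU (F1 X) + EU (F2 X) by rewrite EUD.
have E2 Y : EU (fun X => F1 X Y + F2 X Y) = EU (F1^~ Y) + EU (F2^~ Y).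
  by rewrite EUD.
split=> [X|Y|||]; first exact: polyfunD.
- exact: polyfunD.
- by under boolp.eq_fun do rewrite E1; exact: polyfunD.
- by under boolp.eq_fun do rewrite E2; exact: polyfunD.
under boolp.eq_fun do rewrite E1; rewrite EUD // a5 b5 -EUD //.
by apply: eq_EU => Y _; rewrite E2.
Qed.

(* Both sides equal the double expectation of [f (X^* Y)]: integrating first
   over Y uses the invariance of Y, integrating first over X that of X. *)
Lemma EU_trC f : polyfun f -> EU (fun X => f (X^t*)) = EU f.
Proof.
move=> pf; have [_ _ _ _ H] := sepfun_EU_exchange (sepfun_trC_mul pf).
have pfT : polyfun (fun X => f (X^t*)).
  by apply: polyfun_comp => //; apply: polymx_trC; exact: polymx_id.
transitivity (EU (fun Y => EU (fun X => f (X^t* *m Y)))).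
  rewrite -[LHS]EU_cst; apply: eq_EU => Y uY.
  have uYt : Y^t* \is unitarymx by rewrite trmxC_unitary.
  rewrite -(EU_mull uYt pfT); apply: eq_EU => X _.
  by rewrite trmx_mul map_mxM trmxCK.
rewrite -H -[RHS]EU_cst; apply: eq_EU => X uX.
by apply: EU_mull => //; rewrite trmxC_unitary.
Qed.

End HaarExpectation.

(** * Minors of the first m columns *)

Section Minors.
Variable F : comNzRingType.

(** The sum runs over all functions f: those that are not injective contribute 0 and each m-subset
    is counted m! times, whence the factor on the left. *)
Lemma cauchy_binet (m n : nat) (A : 'M[F]_(m, n)) (B : 'M[F]_(n, m)) :
  \det (A *m B) *+ m`! =
  \sum_(f : {ffun 'I_m -> 'I_n})
     \det (\matrix_(i, j) A i (f j)) * \det (\matrix_(i, j) B (f i) j).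
Proof.
pose D (f : 'I_m -> 'I_n) := \det (\matrix_(i, j) B (f i) j).
have detAB : \det (A *m B) =
    \sum_(f : {ffun 'I_m -> 'I_n}) (\prod_i A i (f i)) * D f.
  transitivity (\sum_(s : 'S_m) (-1) ^+ s *
     \sum_(f : {ffun 'I_m -> 'I_n}) \prod_i (A i (f i) * B (f i) (s i))).
    apply: eq_bigr => s _; congr (_ * _); rewrite -(bigA_distr_bigA (fun i k => A i k * B k (s i))) /=.
    by apply: eq_bigr => i _; rewrite mxE.
  under eq_bigr do rewrite mulr_sumr.
  rewrite exchange_big /=; apply: eq_bigr => f _; rewrite mulr_sumr.
  apply: eq_bigr => s _; rewrite big_split /= mulrCA; congr (_ * (_ * _)).
  by apply: eq_bigr => i _; rewrite mxE.
(* Relabelling f by each of the m! permutations s reproduces \det (A *m B); summed over s, the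
   signed products of entries of A become determinants. *)
transitivity (\sum_(s : 'S_m) \sum_(f : {ffun 'I_m -> 'I_n})
    (-1) ^+ s * (\prod_i A i (f (s i))) * D f); last first.
  rewrite exchange_big; apply: eq_bigr => f _; rewrite -mulr_suml /=.
  congr (_ * _); apply: eq_bigr => s _; congr (_ * _).
  by apply: eq_bigr => i _; rewrite mxE.
rewrite (eq_bigr (fun=> \det (A *m B))) => [|s _].
  by rewrite sumr_const -card_Sn; congr (_ *+ _); apply: eq_card.
rewrite detAB [LHS](reindex (fun f : {ffun _} => [ffun i => f ((s^-1)%g i)])) /=.
  apply: eq_bigr => f _; rewrite [LHS]mulrAC [LHS]mulrC; congr (_ * _).
    by apply: eq_bigr => i _; rewrite ffunE permK.
  have -> : D [ffun i => f ((s^-1)%g i)] =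
      \det (row_perm (s^-1)%g (\matrix_(i, j) B (f i) j)).
    by congr (\det _); apply/matrixP => i j; rewrite !mxE ffunE.
  by rewrite row_permE det_mulmx det_perm odd_permV signrMK.
exists (fun f : {ffun 'I_m -> 'I_n} => [ffun i => f (s i)]) => f _;
  by apply/ffunP => i; rewrite !ffunE ?permK ?permKV.
Qed.

Definition upd (I : eqType) (J : Type) (f : I -> J) (i : I) (r : J) : I -> J :=
  fun x => if x == i then r else f x.

Variables m n : nat.
Implicit Types (f g : 'I_m -> 'I_(m + n)) (X : 'M[F]_(m + n)).

(** The rows are listed by an arbitrary function, possibly unsorted or with repetitions, so that a
    row can be replaced without reordering. *)
Definition minor f X : F := \det (\matrix_(i < m, j < m) X (f i) (lshift n j)).

Lemma minor_upd f X i r : minor (upd f i r) X =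
  \sum_j X r (lshift n j) *
         cofactor (\matrix_(i, j) X (f i) (lshift n j)) i j.
Proof.
rewrite /minor (expand_det_row _ i); apply: eq_bigr => j _.
rewrite mxE /upd eqxx; congr (_ * _); rewrite /cofactor; congr (_ * \det _).
by apply/matrixP => x y; rewrite !mxE eq_sym (negPf (neq_lift _ _)).
Qed.

Lemma eq_minor f g X : f =1 g -> minor f X = minor g X.
Proof. by move=> fg; congr (\det _); apply/matrixP => i j; rewrite !mxE fg. Qed.

Lemma upd_id f i : upd f i (f i) =1 f.
Proof. by move=> x; rewrite /upd; case: eqP => // ->. Qed.

Lemma minorE f X i : minor f X =
  \sum_j X (f i) (lshift n j) *
         cofactor (\matrix_(i, j) X (f i) (lshift n j)) i j.
Proof. by rewrite -minor_upd; apply: eq_minor => x; rewrite upd_id. Qed.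

(* The Pluecker exchange relation, a consequence of Cramer's rule. *)
Lemma minor_exchange f g l X :
  minor f X * minor g X =
  \sum_i minor (upd f i (g l)) X * minor (upd g l (f i)) X.
Proof.
pose M := \matrix_(i < m, j < m) X (f i) (lshift n j).
pose N := \matrix_(i < m, j < m) X (g i) (lshift n j).
(* Insert \adj M *m M = \det M into the expansion of [minor g X] along row l; expanding the matrix
   product instead produces the sum over i. *)
transitivity (\sum_j \sum_k N l j * (\adj M *m M) j k * cofactor N l k).
  rewrite mul_adj_mx -/(minor f X) [minor g X](minorE _ _ l) mulr_sumr.
  apply: eq_bigr => j _; rewrite (bigD1 j) //= big1 ?addr0 => [|k nkj].
    by rewrite !mxE eqxx mulr1n -/N; ring.
  by rewrite [X in _ * X * _]mxE eq_sym (negPf nkj) mulr0n mulr0 mul0r.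
rewrite [RHS](eq_bigr (fun i => \sum_j \sum_k
    N l j * (cofactor M i j * M i k) * cofactor N l k)); last first.
  move=> i _; rewrite !minor_upd -/M -/N big_distrlr /=.
  by apply: eq_bigr => j _; apply: eq_bigr => k _; rewrite !mxE; ring.
rewrite [RHS]exchange_big; apply: eq_bigr => j _ /=.
rewrite [RHS]exchange_big; apply: eq_bigr => k _ /=.
rewrite -mulr_suml -mulr_sumr [(\adj M *m M) j k]mxE.
by congr (_ * _ * _); apply: eq_bigr => i _; rewrite !mxE.
Qed.

Lemma minor_comp_perm f (s : 'S_m) X :
  minor (f \o s) X = (-1) ^+ s * minor f X.
Proof.
rewrite -det_perm -det_mulmx -row_permE; congr (\det _).
by apply/matrixP => i j; rewrite !mxE.
Qed.

Lemma minor_perm_mulmx f (s : 'S_(m + n)) X :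
  minor f (perm_mx s *m X) = minor (s \o f) X.
Proof.
by rewrite -row_permE; congr (\det _); apply/matrixP => i j; rewrite !mxE.
Qed.

Lemma minor_noninj f X i j : i != j -> f i = f j -> minor f X = 0.
Proof.
by move=> nij fij; apply: (determinant_alternate nij) => k; rewrite !mxE fij.
Qed.

End Minors.

(** * Injections, their extensions to permutations, and a weighted count *)

(** Label each point by its preimage, or by [None] outside the image: for any injection the fibres
    have sizes 1 and d - m, so [perm_same_fibres] applies. *)
Lemma inj_perm_ext (m d : nat) (f g : 'I_m -> 'I_d) :
  injective f -> injective g -> exists s : 'S_d, forall i, s (g i) = f i.
Proof.
pose label (h : 'I_m -> 'I_d) x := [pick i | h i == x].
have labelK h : injective h -> forall i, label h (h i) = Some i.
  move=> hI i; rewrite /label; case: pickP => [j /eqP/hI -> //|/(_ i)].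
  by rewrite eqxx.
have card_label (h : 'I_m -> 'I_d) v : injective h ->
    #|[pred x | label h x == v]| = if v is Some _ then 1%N else (d - m)%N.
  move=> hI; case: v => [i|].
    rewrite -(card1 (h i)); apply: eq_card => x; rewrite !inE.
    apply/eqP/eqP => [|->]; last exact: labelK.
    by rewrite /label; case: pickP => // j /eqP <- [->].
  have := cardC (mem (codom h)); rewrite card_codom // !card_ord => dE.
  rewrite -[X in (X - _)%N]dE addKn; apply: eq_card => x; rewrite !inE /label.
  case: pickP => [i /eqP <-|nx]; first by rewrite codom_f.
  by rewrite eqxx; apply/esym/negP => /codomP[i xE]; have := nx i; rewrite xE eqxx.
move=> fI gI; have [v|s sE] := @perm_same_fibres _ _ (label f) (label g).
  by rewrite !card_label.
exists (s^-1)%g => i; apply: (canLR (permK s)).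
have := sE (f i); rewrite labelK // /label; case: pickP => // j /eqP <- [->].
by [].
Qed.

(** The permutations extending a given injection form a coset of those supported on the last n
    indices, so there are n! of them. *)
Lemma sum_perm_lshift (V : nmodType) (m n : nat)
    (h : {ffun 'I_m -> 'I_(m + n)} -> V) :
  \sum_(s : 'S_(m + n)) h [ffun i => s (lshift n i)] =
  (\sum_(f : {ffun 'I_m -> 'I_(m + n)} | injectiveb f) h f) *+ n`!.
Proof.
rewrite (partition_big (fun s : 'S_(m + n) => [ffun i => s (lshift n i)])
  (fun f => injectiveb f)) /=; last first.
  move=> s _; apply/injectiveP => i j; rewrite !ffunE => /perm_inj.
  exact: lshift_inj.
rewrite -sumrMnl; apply: eq_bigr => f /injectiveP fI.
have [s0 s0E] := inj_perm_ext fI (@lshift_inj m n).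
rewrite (eq_bigr (fun=> h f)) => [|s /eqP -> //].
rewrite sumr_const; congr (_ *+ _).
pose A : {set 'I_(m + n)} := [set rshift m i | i in 'I_n].
have <- : #|perm_on A| = n`!.
  by rewrite card_perm card_imset ?card_ord //; exact: rshift_inj.
rewrite -[RHS](card_imset _ (mulIg s0)); apply: eq_card => s.
apply/idP/imsetP => [sf0|[t tA ->]]; last first.
  rewrite -[_ \in _]/([ffun i => (t * s0)%g (lshift n i)] == f).
  apply/eqP/ffunP => i; rewrite ffunE permM (out_perm tA) ?s0E //.
  by apply/negP => /imsetP[j _ /eqP]; rewrite eq_lrshift.
have sf : [ffun i => s (lshift n i)] = f by exact/eqP.
exists (s * s0^-1)%g; last by rewrite mulgKV.
apply/fintype.subsetP => x; rewrite inE; case: (split_ordP x) => i -> nx.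
  case/eqP: nx; rewrite permM; apply: (canLR (permK s0)).
  by rewrite s0E -sf ffunE.
exact: imset_f.
Qed.

Lemma mem_codom_lshift (m n : nat) (x : 'I_(m + n)) :
  (x \in codom (lshift n)) = (x < m)%N.
Proof.
apply/codomP/idP => [[i ->]|xm]; first exact: (ltn_ord i).
by exists (Ordinal xm); apply: val_inj.
Qed.

Definition outside (m d : nat) (f g : 'I_m -> 'I_d) : nat :=
  #|[pred i | f i \notin codom g]|.

(** The functional [L] is integration over [0, 1], which sends X^j to 1 / (j + 1). Giving weight X
    to the indices >= m makes the generating polynomial of [outside] proportional to e_m of m ones
    and n copies of X. *)
Lemma sum_inj_outside (F : numFieldType) (m n : nat) :
  \sum_(f : {ffun 'I_m -> 'I_(m + n)} | injectiveb f)
     ((outside f (lshift n)).+1%:R)^-1 =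
  m`!%:R * 'C((m + n).+1, m)%:R / m.+1%:R :> F.
Proof.
pose a (x : 'I_(m + n)) : {poly F} := if (x < m)%N then 1 else 'X.
pose L (p : {poly F}) : F := \sum_(j < (m + n).+1) p`_j / j.+1%:R.
have L_sum (I : finType) (p : I -> {poly F}) : L (\sum_i p i) = \sum_i L (p i).
  rewrite /L exchange_big; apply: eq_bigr => j _ /=.
  by rewrite coef_sum mulr_suml.
have L_Mn p k : L (p *+ k) = L p *+ k.
  by rewrite /L -sumrMnl; apply: eq_bigr => j _; rewrite coefMn mulrnAl.
have L_ZXn c k : (k <= m + n)%N -> L (c *: 'X^k) = c / k.+1%:R.
  move=> lek; rewrite /L (bigD1 (Ordinal (lek : (k < (m + n).+1)%N))) //= big1.
    by rewrite coefZ coefXn eqxx mulr1 addr0.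
  move=> j; rewrite -val_eqE /= => njk.
  by rewrite coefZ coefXn (negPf njk) mulr0 mul0r.
have prodE (s : 'S_(m + n)) : \prod_(i in ords (m + n) m) a (s i) =
    'X^(outside [ffun i => s (lshift n i)] (lshift n)).
  rewrite big_mkcond big_split_ord /= [X in _ * X]big1 ?mulr1; last first.
    by move=> i _; rewrite inE /= ltnNge leq_addr.
  rewrite -prodr_const [RHS]big_mkcond; apply: eq_bigr => i _.
  by rewrite !inE ffunE mem_codom_lshift /a /= ltn_ord; case: ltnP.
have eE : elem_sym a m = \sum_(j < n.+1) ('C(m, j) * 'C(n, j))%:R *: 'X^j.
  rewrite elem_sym_coef ?leq_addr // addKn.
  rewrite (prod_prefix01 (fun b : bool => 'X + (if b then 1 else 'X)%:P)) ?leq_addr //.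
  rewrite addKn coefM; apply: eq_bigr => j _; rewrite !coef_XaddC_exp expr1n mulr1.
  have lejn : (j <= n)%N by rewrite -ltnS.
  by rewrite bin_sub // subKn // mulrA -natrM scaler_nat mulr_natl.
have := congr1 L (sum_perm_prod_mulrn (ords (m + n) m) a).
rewrite card_ords ?leq_addr // !L_Mn (eq_bigr _ (fun s _ => prodE s)) eE !L_sum.
have LX (s : 'S_(m + n)) : L 'X^(outside [ffun i => s (lshift n i)] (lshift n)) =
    ((outside [ffun i => s (lshift n i)] (lshift n)).+1%:R)^-1.
  rewrite -[X in L X]scale1r L_ZXn ?mul1r //; apply: leq_trans (leq_addr _ _).
  by rewrite -[X in (_ <= X)%N]card_ord max_card.
under eq_bigr do rewrite LX.
rewrite (sum_perm_lshift (fun f => ((outside f (lshift n)).+1%:R)^-1 : F)).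
set N := \sum_(f | _) _.
(* 'C(m, j) / (j + 1) equals 'C(m + 1, j + 1) / (m + 1), which leaves a Vandermonde sum. *)
have -> : \sum_(j < n.+1) L (('C(m, j) * 'C(n, j))%:R *: 'X^j) =
    'C((m + n).+1, m)%:R / m.+1%:R.
  have -> : 'C((m + n).+1, m) = 'C(m.+1 + n, n.+1).
    by rewrite -bin_sub; [congr 'C(_, _)|]; lia.
  rewrite -binomial.Vandermonde big_ord_recl subn0 [X in (_ * X + _)%N]bin_small // muln0.
  rewrite add0n natr_sum mulr_suml; apply: eq_bigr => j _.
  have lejn : (j <= n)%N by rewrite -ltnS.
  rewrite L_ZXn; last by apply: leq_trans lejn (leq_addl _ _).
  rewrite lift0 subSS bin_sub // natrM natrM mulrAC [RHS]mulrAC; congr (_ * _).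
  apply/eqP; rewrite eqr_div ?pnatr_eq0 // -!natrM eqr_nat mulnC.
  by rewrite mul_bin_diag mulnC.
have C0 : 'C(m + n, m)%:R != 0 :> F by rewrite pnatr_eq0 -lt0n bin_gt0 leq_addr.
have f0 k : k`!%:R != 0 :> F by rewrite pnatr_eq0 -lt0n fact_gt0.
set X := _ / _; move=> E.
have {}E : N * n`!%:R * 'C(m + n, m)%:R = X * (m + n)`!%:R by rewrite !mulr_natr.
apply: (mulIf (mulf_neq0 (f0 n) C0)).
rewrite mulrA E -[m`!%:R * _ / _]mulrA -/X -(bin_fact (leq_addr n m)) addKn !natrM.
by clear; move: X m`!%:R n`!%:R 'C(m + n, m)%:R => X x y z; ring.
Qed.

(** * Rotations of two rows and their effect on minors *)

Section Rotation.
Local Open Scope sesquilinear_scope.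
Variables (C : numClosedFieldType) (d : nat) (p q : 'I_d) (c s w : C).

(** Rotation in the plane of the coordinates p and q with cosine c, sine s and phase w; all other
    coordinates are fixed. *)
Definition rotmx : 'M[C]_d := \matrix_(i, j)
  if i == p then c * (j == p)%:R + s * w * (j == q)%:R
  else if i == q then c * (j == q)%:R - s * w^* * (j == p)%:R
  else (j == i)%:R.

Lemma sum_delta (a : C) (r : 'I_d) (x : 'I_d -> C) :
  \sum_k a * (k == r)%:R * x k = a * x r.
Proof.
rewrite (bigD1 r) //= eqxx mulr1 big1 ?addr0 // => k /negPf ->.
by rewrite mulr0 mul0r.
Qed.

Lemma rotmx_mul n (X : 'M[C]_(d, n)) i j : (rotmx *m X) i j =
  if i == p then c * X p j + s * w * X q j
  else if i == q then c * X q j - s * w^* * X p j else X i j.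
Proof.
rewrite mxE; under eq_bigr do rewrite mxE.
case: ifP => _; last case: ifP => _.
- under eq_bigr do rewrite mulrDl.
  by rewrite big_split /= !(sum_delta _ _ (fun k => X k j)).
- under eq_bigr do rewrite mulrBl.
  by rewrite sumrB !(sum_delta _ _ (fun k => X k j)).
- under eq_bigr do rewrite -[_%:R]mul1r.
  by rewrite (sum_delta _ _ (fun k => X k j)) mul1r.
Qed.

Lemma rotmx_unitary : p != q -> c^* = c -> s^* = s -> c * c + s * s = 1 ->
  w * w^* = 1 -> rotmx \is unitarymx.
Proof.
move=> npq cJ sJ cs ww; apply/unitarymxP/matrixP => i j.
have nqp : q != p by rewrite eq_sym.
rewrite rotmx_mul !mxE.
have [->|nip] := eqVneq i p; last have [->|niq] := eqVneq i q.
- have [jp|njp] := eqVneq j p; last have [jq|njq] := eqVneq j q; rewrite ?jp ?jq.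
  + rewrite !eqxx (negPf npq) (negPf nqp) !(mulr1, mulr0, addr0, add0r).
    rewrite cJ rmorphM /= sJ -cs; congr (_ + _).
    by rewrite mulrACA ww mulr1.
  + rewrite !eqxx (negPf npq) (negPf nqp) !(mulr1, mulr0, addr0, add0r, sub0r, subr0).
    by rewrite cJ rmorphN rmorphM /= conjCK sJ; ring.
  + by rewrite ?[_ == j]eq_sym ?(negPf njp) ?(negPf njq) ?rmorph0 !mulr0 addr0.
- have [jp|njp] := eqVneq j p; last have [jq|njq] := eqVneq j q; rewrite ?jp ?jq.
  + rewrite !eqxx (negPf npq) (negPf nqp) !(mulr1, mulr0, addr0, add0r, sub0r, subr0).
    by rewrite cJ rmorphM /= sJ; ring.
  + rewrite !eqxx (negPf npq) (negPf nqp) !(mulr1, mulr0, addr0, add0r, sub0r, subr0).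
    rewrite cJ rmorphN rmorphM /= conjCK sJ -cs mulrN opprK; congr (_ + _).
    by rewrite mulrACA [_^* * _]mulrC ww mulr1.
  + by rewrite ?[_ == j]eq_sym ?(negPf njp) ?(negPf njq) ?rmorph0 !mulr0 subr0.
- have [jp|njp] := eqVneq j p; last have [jq|njq] := eqVneq j q; rewrite ?jp ?jq.
  + by rewrite ?(negPf nip) ?(negPf niq) !mulr0 addr0 rmorph0.
  + by rewrite ?(negPf nip) ?(negPf niq) !mulr0 subr0 rmorph0.
  + by rewrite rmorph_nat.
Qed.

End Rotation.

Section RotatedMinors.
Variables (C : numClosedFieldType) (m n : nat) (p q : 'I_(m + n)) (c s w : C).
Implicit Types (f g : 'I_m -> 'I_(m + n)) (X Y : 'M[C]_(m + n)).

Lemma minor_row f X Y i :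
  (forall x, x != i -> forall j, Y (f x) j = X (f x) j) ->
  minor f Y = \sum_j Y (f i) (lshift n j) *
     cofactor (\matrix_(i, j) X (f i) (lshift n j)) i j.
Proof.
move=> XY; rewrite (minorE _ _ i); apply: eq_bigr => j _; congr (_ * _).
rewrite /cofactor; congr (_ * \det _); apply/matrixP => x y; rewrite !mxE.
by rewrite XY // eq_sym neq_lift.
Qed.

(** Among the rows listed by f the rotation alters only row p, since q is not listed; the rest is
    linearity in that row. *)
Lemma minor_rotmx_l f i X : injective f -> f i = p -> q \notin codom f ->
  minor f (rotmx p q c s w *m X) =
  c * minor f X + s * w * minor (upd f i q) X.
Proof.
move=> fI fi nq; rewrite (@minor_row _ X _ i) => [|x nxi j].
  rewrite minor_upd (minorE _ _ i) !mulr_sumr -big_split /=.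
  by apply: eq_bigr => j _; rewrite rotmx_mul fi eqxx mulrDl !mulrA.
rewrite rotmx_mul -fi (inj_eq fI) (negPf nxi).
by case: eqP => // fx; rewrite -fx codom_f in nq.
Qed.

Lemma minor_rotmx_r g l X : injective g -> g l = q -> p \notin codom g ->
  minor g (rotmx p q c s w *m X) =
  c * minor g X - s * w^* * minor (upd g l p) X.
Proof.
move=> gI gl np; have npq : q != p.
  by apply: contraNneq np => <-; rewrite -gl codom_f.
rewrite (@minor_row _ X _ l) => [|x nxl j].
  rewrite minor_upd (minorE _ _ l) !mulr_sumr -sumrB.
  by apply: eq_bigr => j _; rewrite rotmx_mul gl (negPf npq) eqxx mulrBl !mulrA.
rewrite rotmx_mul -gl (inj_eq gI) (negPf nxl).
by case: eqP => // gx; rewrite -gx codom_f in np.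
Qed.

End RotatedMinors.

(* Averaging over the phases w = 1, i, -1, -i kills the terms that are not
   invariant under phase changes. *)
Lemma phase_average (C : numClosedFieldType) (z0 z1 z2 z3 : C) :
  let Q w := (9%:R * z0 - 16%:R * z3 + w * (12%:R * z2) - w^* * (12%:R * z1)) / 25%:R in
  Q 1 * (Q 1)^* + Q 'i * (Q 'i)^* + Q (-1) * (Q (-1))^* + Q (- 'i) * (Q (- 'i))^* =
  4%:R / 625%:R * (81%:R * (z0 * z0^*) + 256%:R * (z3 * z3^*)
    + (-144%:R) * (z0 * z3^*) + (-144%:R) * (z3 * z0^*)
    + 144%:R * (z1 * z1^*) + 144%:R * (z2 * z2^*)).
Proof.
have QJ w : ((9%:R * z0 - 16%:R * z3 + w * (12%:R * z2) - w^* * (12%:R * z1)) / 25%:R)^*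
    = (9%:R * z0^* - 16%:R * z3^* + w^* * (12%:R * z2^*) - w * (12%:R * z1^*)) / 25%:R.
  rewrite fmorph_div rmorph_nat rmorphB rmorphD rmorphB !rmorphM /= conjCK.
  by rewrite !rmorph_nat.
move=> Q; rewrite /Q !QJ !rmorphN /= !conjC1 conjCi opprK.
have ii : 'i * 'i = -1 :> C by rewrite -expr2 sqrCi.
move: (z0^*) (z1^*) (z2^*) (z3^*) => y0 y1 y2 y3.
move: 'i ii => j jj.
set A := 9%:R * z0 - 16%:R * z3; set B := 9%:R * y0 - 16%:R * y3.
transitivity ((4%:R * (A * B) + 2%:R * (144%:R * ((z2 - z1) * (y2 - y1)))
  - 2%:R * (j * j) * (144%:R * ((z2 + z1) * (y2 + y1)))) / 625%:R); first by field.
by rewrite jj /A /B; field.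
Qed.

(** * A linear relation between mixed moments of two minors *)

Section PairMoments.
Local Open Scope complex_scope.
Local Open Scope sesquilinear_scope.
Variables (R : realType) (disp : measure_display) (T : measurableType disp).
Variables (P : probability T R) (m n : nat) (U : T -> 'M[R[i]]_(m + n)).
Hypothesis hU : haar_unitary P U.
Local Notation C := R[i].
Local Notation E := (EU P U).
Implicit Types (f g : 'I_m -> 'I_(m + n)).

Definition moment f g f' g' : C :=
  E (fun X => minor f X * minor g X * (minor f' X * minor g' X)^*%R).

Lemma polyfun_minor f : polyfun (minor f : 'M[C]_(m + n) -> C).
Proof.
by apply: polyfun_det => i j; under boolp.eq_fun do rewrite mxE; exact: polyfun_entry.
Qed.

Lemma polyfun_moment f g f' g' :
  polyfun (fun X : 'M[C]_(m + n) =>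
    minor f X * minor g X * (minor f' X * minor g' X)^*%R).
Proof.
apply: polyfunM; first by apply: polyfunM; exact: polyfun_minor.
by apply: polyfun_conj; apply: polyfunM; exact: polyfun_minor.
Qed.

Lemma eq_moment f1 g1 f2 g2 f1' g1' f2' g2' :
  f1 =1 f1' -> g1 =1 g1' -> f2 =1 f2' -> g2 =1 g2' ->
  moment f1 g1 f2 g2 = moment f1' g1' f2' g2'.
Proof. by do 4!move=> /boolp.funext ->. Qed.

Lemma perm_mx_unitary (s : 'S_(m + n)) : perm_mx s \is @unitarymx C _ _.
Proof.
by apply/unitarymxP; rewrite tr_perm_mx map_perm_mx -perm_mxM mulgV perm_mx1.
Qed.

Lemma moment_perm (s : 'S_(m + n)) f g f' g' :
  moment (s \o f) (s \o g) (s \o f') (s \o g') = moment f g f' g'.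
Proof.
rewrite -[RHS](EU_mull hU (perm_mx_unitary s) (polyfun_moment f g f' g')).
by apply: (eq_EU hU) => X _; rewrite !minor_perm_mulmx.
Qed.

(** The integrand on the right is |minor f * minor g|^2 after a rotation of the rows f i and g l.
    The phase w stays free so that it can be averaged out. *)
Lemma moment_rotate f g i l (w : C) : injective f -> injective g ->
  f i \notin codom g -> g l \notin codom f -> w * w^*%R = 1 ->
  let f' := upd f i (g l) in let g' := upd g l (f i) in
  moment f g f g = E (fun X =>
    ((9%:R * (minor f X * minor g X) - 16%:R * (minor f' X * minor g' X)
       + w * (12%:R * (minor f' X * minor g X))
       - w^*%R * (12%:R * (minor f X * minor g' X))) / 25%:R) *
    ((9%:R * (minor f X * minor g X) - 16%:R * (minor f' X * minor g' X)
       + w * (12%:R * (minor f' X * minor g X))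
       - w^*%R * (12%:R * (minor f X * minor g' X))) / 25%:R)^*%R).
Proof.
move=> fI gI nfi ngl ww f' g'.
(* A rational point of the unit circle: c^2, s^2 and c s are 9, 16 and 12 over 25. *)
pose c : C := 3%:R / 5%:R; pose s : C := 4%:R / 5%:R.
have npq : f i != g l by apply: contraNneq ngl => <-; exact: codom_f.
have uV : rotmx (f i) (g l) c s w \is unitarymx.
  apply: rotmx_unitary => //.
  - by rewrite /c fmorph_div !rmorph_nat.
  - by rewrite /s fmorph_div !rmorph_nat.
  - by rewrite /c /s; field.
rewrite /moment -(EU_mull hU uV (polyfun_moment f g f g)).
apply: (eq_EU hU) => X _; congr (_ * _^*).
all: rewrite (minor_rotmx_l _ _ _ _ fI (erefl _) ngl).
all: rewrite (minor_rotmx_r _ _ _ _ gI (erefl _) nfi) -/f' -/g'.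
all: rewrite (_ : (c * minor f X + s * w * minor f' X) *
  (c * minor g X - s * w^*%R * minor g' X) =
  c * c * (minor f X * minor g X) - s * s * (w * w^*%R) * (minor f' X * minor g' X)
  + w * (c * s * (minor f' X * minor g X))
  - w^*%R * (c * s * (minor f X * minor g' X))); last by ring.
all: by rewrite ww /c /s; field.
Qed.

(** The transposition of the rows f i and g l exchanges f with f' and g with g'. *)
Lemma moment_swap f g i l : injective f -> injective g ->
  f i \notin codom g -> g l \notin codom f ->
  let f' := upd f i (g l) in let g' := upd g l (f i) in
  [/\ moment f' g' f' g' = moment f g f g,
      moment f' g' f g = moment f g f' g' &
      moment f g' f g' = moment f' g f' g].
Proof.
move=> fI gI nfi ngl f' g'; pose t := tperm (f i) (g l).
have tf : t \o f =1 f'.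
  move=> x; rewrite /= /f' /upd; case: eqP => [->|/eqP nxi]; first exact: tpermL.
  rewrite tpermD //; first by rewrite (inj_eq fI) eq_sym.
  by apply: contraNneq ngl => ->; exact: codom_f.
have tg : t \o g =1 g'.
  move=> x; rewrite /= /g' /upd; case: eqP => [->|/eqP nxl]; first exact: tpermR.
  rewrite tpermD //; last by rewrite (inj_eq gI) eq_sym.
  by apply: contraNneq nfi => ->; exact: codom_f.
have tf' : t \o f' =1 f by move=> x; rewrite /= -tf /= tpermK.
have tg' : t \o g' =1 g by move=> x; rewrite /= -tg /= tpermK.
split.
- by rewrite -[RHS](moment_perm t); apply: eq_moment => x; rewrite ?tf ?tg.
- by rewrite -[RHS](moment_perm t); apply: eq_moment => x; rewrite ?tf ?tg ?tf' ?tg'.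
- by rewrite -[RHS](moment_perm t); apply: eq_moment => x; rewrite ?tf ?tg ?tf' ?tg'.
Qed.

(** Average [moment_rotate] over four phases and identify moments by [moment_swap]. The relation
    expresses the cross moment, which the exchange relation produces, through expectations of
    squared moduli. *)
Lemma moment_exchange f g i l : injective f -> injective g ->
  f i \notin codom g -> g l \notin codom f ->
  let f' := upd f i (g l) in let g' := upd g l (f i) in
  moment f g f' g' + moment f g f g = moment f' g f' g.
Proof.
move=> fI gI nfi ngl f' g'.
have [] := moment_swap fI gI nfi ngl; rewrite -/f' -/g' => S1 S2 S3.
pose Z0 X : C := minor f X * minor g X; pose Z1 X : C := minor f X * minor g' X.
pose Z2 X : C := minor f' X * minor g X; pose Z3 X : C := minor f' X * minor g' X.
pose Q w X : C :=
  (9%:R * Z0 X - 16%:R * Z3 X + w * (12%:R * Z2 X) - w^*%R * (12%:R * Z1 X)) / 25%:R.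
have rot w : w * w^*%R = 1 -> moment f g f g = E (fun X => Q w X * (Q w X)^*%R).
  exact: moment_rotate.
have pQ w : polyfun (fun X => Q w X * (Q w X)^*%R).
  suff pQ : polyfun (Q w) by exact: (polyfunM pQ (polyfun_conj pQ)).
  have pM h k : polyfun (fun X : 'M[C]_(m + n) => minor h X * minor k X).
    by apply: polyfunM; exact: polyfun_minor.
  have pZ (a : C) (G : 'M[C]_(m + n) -> C) : polyfun G -> polyfun (fun X : 'M[C]_(m + n) => a * G X).
    by move=> pG; exact: (polyfunM (polyfun_cst _ a) pG).
  have p1 := polyfunB (pZ 9%:R _ (pM f g)) (pZ 16%:R _ (pM f' g')).
  have p2 := polyfunD p1 (pZ w _ (pZ 12%:R _ (pM f' g))).
  exact: (polyfunM (polyfunB p2 (pZ _ _ (pZ 12%:R _ (pM f g')))) (polyfun_cst _ _)).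
have ii : 'i * 'i = -1 :> C by rewrite -expr2 sqrCi.
have Ji : ('i : C)^*%R = - 'i by exact: conjCi.
have J1 : (-1 : C)^*%R = -1 by rewrite rmorphN rmorph1.
have JNi : (- 'i : C)^*%R = 'i by rewrite rmorphN /= Ji opprK.
have pm := polyfun_moment; have pc c := @polyfun_cst R (m + n) c.
have lin (b a1 a2 a3 a4 a5 a6 : C) (M1 M2 M3 M4 M5 M6 : 'M[C]_(m + n) -> C) :
    polyfun M1 -> polyfun M2 -> polyfun M3 -> polyfun M4 -> polyfun M5 ->
    polyfun M6 ->
    E (fun X => b * (a1 * M1 X + a2 * M2 X + a3 * M3 X + a4 * M4 X
                     + a5 * M5 X + a6 * M6 X)) =
    b * (a1 * E M1 + a2 * E M2 + a3 * E M3 + a4 * E M4 + a5 * E M5 + a6 * E M6).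
  move=> p1 p2 p3 p4 p5 p6.
  have q1 := polyfunM (pc a1) p1; have q2 := polyfunM (pc a2) p2.
  have q3 := polyfunM (pc a3) p3; have q4 := polyfunM (pc a4) p4.
  have q5 := polyfunM (pc a5) p5; have q6 := polyfunM (pc a6) p6.
  have s2 := polyfunD q1 q2; have s3 := polyfunD s2 q3; have s4 := polyfunD s3 q4.
  have s5 := polyfunD s4 q5; have s6 := polyfunD s5 q6.
  rewrite (EUZ hU b s6) (EUD hU s5 q6) (EUD hU s4 q5) (EUD hU s3 q4) (EUD hU s2 q3).
  rewrite (EUD hU q1 q2) (EUZ hU a1 p1) (EUZ hU a2 p2) (EUZ hU a3 p3).
  by rewrite (EUZ hU a4 p4) (EUZ hU a5 p5) (EUZ hU a6 p6).
have sumE : E (fun X => Q 1 X * (Q 1 X)^*%R) + E (fun X => Q 'i X * (Q 'i X)^*%R)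
  + E (fun X => Q (-1) X * (Q (-1) X)^*%R)
  + E (fun X => Q (- 'i) X * (Q (- 'i) X)^*%R) =
  4%:R / 625%:R * (81%:R * moment f g f g + 256%:R * moment f' g' f' g'
   + (-144%:R) * moment f g f' g' + (-144%:R) * moment f' g' f g
   + 144%:R * moment f g' f g' + 144%:R * moment f' g f' g).
  rewrite -(lin _ _ _ _ _ _ _ _ _ _ _ _ _ (pm f g f g) (pm f' g' f' g')
    (pm f g f' g') (pm f' g' f g) (pm f g' f g') (pm f' g f' g)).
  rewrite -(EUD hU (pQ 1) (pQ 'i)); have r2 := polyfunD (pQ 1) (pQ 'i).
  rewrite -(EUD hU r2 (pQ (-1))); have r3 := polyfunD r2 (pQ (-1)).
  rewrite -(EUD hU r3 (pQ (- 'i))).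
  apply: (eq_EU hU) => X _.
  exact: phase_average.
have w1 : 1 * (1 : C)^*%R = 1 by rewrite conjC1 mulr1.
have wi : 'i * ('i : C)^*%R = 1 by rewrite Ji mulrN ii opprK.
have wN1 : -1 * (-1 : C)^*%R = 1 by rewrite J1 mulrNN mulr1.
have wNi : - 'i * (- 'i : C)^*%R = 1 by rewrite JNi mulNr ii opprK.
rewrite -(rot _ w1) -(rot _ wi) -(rot _ wN1) -(rot _ wNi) in sumE.
move: sumE; rewrite S1 S2 S3.
move: (moment f g f g) (moment f g f' g') (moment f' g f' g) => x y z xyz.
(* Here c^4 + s^4 = 1 - 2 c^2 s^2, so the four rotations together give 8 c^2 s^2 = 1152/625 times
   the relation. *)
have {}xyz : 1152%:R / 625%:R * (y + x - z) = 0.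
  by apply: etrans (subrr (x + x + x + x)); rewrite {2}xyz; field.
apply/eqP; rewrite -subr_eq0; apply/eqP; apply: (mulfI _ (etrans xyz (esym (mulr0 _)))).
by rewrite mulf_neq0 ?invr_eq0 ?pnatr_eq0.
Qed.

End PairMoments.

(** * Values of the moments *)

Section MomentValues.
Local Open Scope complex_scope.
Local Open Scope sesquilinear_scope.
Variables (R : realType) (disp : measure_display) (T : measurableType disp).
Variables (P : probability T R) (m n : nat) (U : T -> 'M[R[i]]_(m + n)).
Hypothesis hU : haar_unitary P U.
Local Notation C := R[i].
Local Notation E := (EU P U).
Local Notation moment := (moment P U).
Implicit Types (f g : 'I_m -> 'I_(m + n)).

(** Here f is a rearrangement of g, and its sign cancels against its conjugate. *)
Lemma moment_codom f g : injective f -> injective g -> outside f g = 0%N ->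
  moment f g f g = moment g g g g.
Proof.
move=> fI gI fg0.
have H i : f i \in codom g by have /card0_eq/(_ i) := fg0; rewrite !inE => /negbFE.
have gh i : g (iinv (H i)) = f i by exact: f_iinv.
have hI : injective (fun i => iinv (H i)) by move=> i j /(congr1 g); rewrite !gh => /fI.
have fE : f =1 g \o perm hI by move=> i; rewrite /= permE gh.
apply: (eq_EU hU) => X _; rewrite (eq_minor _ fE) minor_comp_perm.
rewrite !rmorphM rmorph_sign /=.
have : (-1) ^+ perm hI * (-1) ^+ perm hI = 1 :> C by rewrite -expr2 sqrr_sign.
move: ((-1) ^+ _) (minor g X) => s x ss; move: (x^*%R) => y.
by rewrite -[RHS]mul1r -ss; ring.
Qed.

Lemma exists_outside f g : injective f -> injective g -> (0 < outside f g)%N ->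
  exists l, g l \notin codom f.
Proof.
move=> fI gI fg; apply/existsP; apply: contraTT fg => /existsPn gf.
rewrite -leqNgt leqn0; apply/eqP/eq_card0 => i; rewrite !inE; apply/negbF.
have cgf : #|codom g| = #|codom f| by rewrite !card_codom.
have sgf : codom g \subset codom f.
  by apply/fintype.subsetP => _ /codomP[l ->]; exact: negbNE (gf l).
by rewrite (subset_cardP cgf sgf) codom_f.
Qed.

Lemma upd_inj f i r : injective f -> r \notin codom f -> injective (upd f i r).
Proof.
move=> fI nr x y; rewrite /upd; case: eqP => [->|_]; case: eqP => [->|_] //.
- by move=> rE; rewrite rE codom_f in nr.
- by move=> rE; rewrite -rE codom_f in nr.
- exact: fI.
Qed.

Lemma outside_upd f g i l : f i \notin codom g ->
  outside f g = (outside (upd f i (g l)) g).+1.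
Proof.
move=> nfi; rewrite /outside (cardD1 i) inE nfi add1n; congr _.+1.
apply: eq_card => x; rewrite !inE /upd; case: eqP => //= _.
by rewrite codom_f.
Qed.

(** Induction on the number k + 1 of rows of f outside g. With x the moment of f, g and y that of g,
    g, the exchange relation and the induction hypothesis for the updated f give x = (k + 1) (y / (k
    + 1) - x), that is (k + 2) x = y. *)
Lemma moment_outside f g : injective f -> injective g ->
  moment f g f g = moment g g g g / (outside f g).+1%:R.
Proof.
move=> + gI; move Ek: (outside f g) => k.
elim: k f Ek => [|k IH] f Ek fI; first by rewrite divr1; exact: moment_codom.
have [|l ngl] := exists_outside fI gI; first by rewrite Ek.
have xE : moment f g f g =
    \sum_i moment f g (upd f i (g l)) (upd g l (f i)).
  rewrite -(EU_sum hU); last by move=> i; exact: polyfun_moment.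
  apply: (eq_EU hU) => X _; rewrite -mulr_sumr -rmorph_sum; congr (_ * _^*).
  exact: minor_exchange.
(* If f i is already a row of g, the updated g lists it twice and its minor vanishes. *)
have iE i : moment f g (upd f i (g l)) (upd g l (f i)) =
    if f i \notin codom g then moment g g g g / k.+1%:R - moment f g f g else 0.
  case: ifP => [nfi|/negbFE/codomP[l' fil']].
    have := moment_exchange hU fI gI nfi ngl => /=.
    rewrite (IH (upd f i (g l))); first by move<-; rewrite addrK.
      by have := outside_upd l nfi; rewrite Ek => -[].
    exact: upd_inj.
  rewrite -(EU_cst P U 0); apply: (eq_EU hU) => X _.
  have nll' : l != l' by apply: contraNneq ngl => ->; rewrite -fil' codom_f.
  rewrite (@minor_noninj _ _ _ (upd g l (f i)) X l l') // ?mulr0 ?rmorph0 ?mulr0 //.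
  by rewrite /upd eqxx eq_sym (negPf nll').
move: xE; rewrite (eq_bigr _ (fun i _ => iE i)) -big_mkcond sumr_const.
rewrite -/(outside f g) Ek.
move: (moment f g f g) (moment g g g g) => x y.
rewrite -[(_ - _) *+ _]mulr_natr mulrBl divfK ?pnatr_eq0 // => xE.
apply: (mulIf (_ : k.+2%:R != 0)); first by rewrite pnatr_eq0.
rewrite divfK ?pnatr_eq0 // -[k.+2]addn1 natrD mulrDr mulr1.
by rewrite {2}xE addrC subrK.
Qed.

(** Cauchy-Binet for the first m columns, which are orthonormal. *)
Lemma sum_minor_sqr (X : 'M[C]_(m + n)) : X \is unitarymx ->
  \sum_(f : {ffun 'I_m -> 'I_(m + n)}) minor f X * (minor f X)^*%R = m`!%:R.
Proof.
move=> /unitarymxP/mulmx1C XX.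
pose W := \matrix_(i < m + n, j < m) X i (lshift n j).
have WW : W^t* *m W = 1%:M.
  apply/matrixP => i j; have /matrixP/(_ (lshift n i) (lshift n j)) := XX.
  rewrite !mxE eq_lshift => <-; apply: eq_bigr => k _; by rewrite !mxE.
have := cauchy_binet (W^t*) W; rewrite WW det1 => ->.
apply: eq_bigr => f _; rewrite mulrC; congr (_ * _); last first.
  by congr (\det _); apply/matrixP => i j; rewrite !mxE.
rewrite /minor -det_map_mx -det_tr; congr (\det _).
by apply/matrixP => i j; rewrite !mxE.
Qed.

Let polyfun_sqr f : polyfun (fun X : 'M[C]_(m + n) => minor f X * (minor f X)^*%R).
Proof. exact: (polyfunM (polyfun_minor _ f) (polyfun_conj (polyfun_minor _ f))). Qed.

(** By row permutations all sets of m rows have the same expectation, and there are 'C(m + n, m) of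
    them. *)
Lemma E_minor_sqr :
  E (fun X => minor (lshift n) X * (minor (lshift n) X)^*%R) =
  ('C(m + n, m)%:R)^-1.
Proof.
pose e f : C := E (fun X => minor f X * (minor f X)^*%R).
have eP (s : 'S_(m + n)) : e [ffun i => s (lshift n i)] = e (lshift n).
  rewrite -[RHS](EU_mull hU (perm_mx_unitary _ s) (polyfun_sqr (lshift n))).
  apply: (eq_EU hU) => X _; rewrite !minor_perm_mulmx.
  by rewrite (@eq_minor _ _ _ _ (s \o lshift n)) // => i; rewrite ffunE.
have := sum_perm_lshift (fun f : {ffun 'I_m -> 'I_(m + n)} => e f).
rewrite (eq_bigr _ (fun s _ => eP s)) sumr_const.
have -> : \sum_(f : {ffun 'I_m -> 'I_(m + n)} | injectiveb f) e f = m`!%:R.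
  rewrite big_mkcond -(EU_cst P U (m`!%:R)).
  rewrite -(eq_EU hU (fun X uX => sum_minor_sqr uX)) (EU_sum hU) //.
  apply: eq_bigr => f _; case: injectiveP => // /injectiveP nfI.
  have /injectivePn[i [j nij fij]] := nfI.
  rewrite -(EU_cst P U 0); apply: (eq_EU hU) => X _.
  by rewrite (minor_noninj _ nij fij) mul0r.
rewrite -/(e _) (_ : #|_| = (m + n)`!); last by rewrite -card_Sn; apply: eq_card.
move: (e _) => x; rewrite -(bin_fact (leq_addr n m)) addKn => xE.
have f0 k : k`!%:R != 0 :> C by rewrite pnatr_eq0 -lt0n fact_gt0.
have C0 : 'C(m + n, m)%:R != 0 :> C by rewrite pnatr_eq0 -lt0n bin_gt0 leq_addr.
have {}xE : x * ('C(m + n, m)%:R * (m`!%:R * n`!%:R)) = m`!%:R * n`!%:R.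
  by rewrite -!natrM mulr_natr xE natrM mulr_natr.
apply: (mulIf (mulf_neq0 C0 (mulf_neq0 (f0 m) (f0 n)))).
by rewrite xE mulKf.
Qed.

(** Multiply the constant sum of the |minors|^2 by one |minor|^2 and take expectations:
    [moment_outside] writes each term as a fraction of the unknown x, and [sum_inj_outside] adds up
    the fractions. *)
Lemma moment_lshift : moment (lshift n) (lshift n) (lshift n) (lshift n) =
  m.+1%:R / ('C(m + n, m)%:R * 'C((m + n).+1, m)%:R).
Proof.
set x := moment _ _ _ _.
have : \sum_(f : {ffun 'I_m -> 'I_(m + n)}) moment f (lshift n) f (lshift n) =
    m`!%:R / 'C(m + n, m)%:R.
  rewrite -(EU_sum hU); last by move=> f; exact: polyfun_moment.
  rewrite -E_minor_sqr -(EUZ hU _ (polyfun_sqr (lshift n))).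
  apply: (eq_EU hU) => X uX; rewrite -(sum_minor_sqr uX) mulr_suml.
  by apply: eq_bigr => f _; rewrite rmorphM mulrACA.
rewrite (bigID (fun f : {ffun _} => injectiveb f)) /= [X in _ + X]big1 ?addr0.
  have fE (f : {ffun 'I_m -> 'I_(m + n)}) : injectiveb f ->
      moment f (lshift n) f (lshift n) =
      x * ((outside f (lshift n)).+1%:R)^-1.
    move=> /injectiveP fI; rewrite moment_outside //; exact: lshift_inj.
  rewrite (eq_bigr _ fE) -mulr_sumr sum_inj_outside => xE.
  have f0 k : k`!%:R != 0 :> C by rewrite pnatr_eq0 -lt0n fact_gt0.
  have C0 : 'C(m + n, m)%:R != 0 :> C by rewrite pnatr_eq0 -lt0n bin_gt0 leq_addr.
  have C1 : 'C((m + n).+1, m)%:R != 0 :> C.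
    by rewrite pnatr_eq0 -lt0n bin_gt0 leqW // leq_addr.
  have m0 : m.+1%:R != 0 :> C by rewrite pnatr_eq0.
  move: xE (f0 m) C0 C1 m0.
  move: m`!%:R 'C(m + n, m)%:R 'C((m + n).+1, m)%:R m.+1%:R => a b c k xE a0 b0 c0 k0.
  apply: (mulIf (_ : a * c / k != 0)).
    by rewrite !mulf_neq0 ?invr_eq0.
  by rewrite xE; field; rewrite b0 c0 k0.
move=> f /injectivePn[i [j nij fij]].
rewrite -(EU_cst P U 0); apply: (eq_EU hU) => X _.
by rewrite (minor_noninj _ nij fij) !mul0r.
Qed.

End MomentValues.

(** * The commutator of two coordinate projections *)

(** A Schur complement without inverting X: a block triangular factor of determinant X^m gives \chi
    * X^m = \det (X^2 - G K) * X^n. The required coefficient of \chi, at X^(n - m), is thus the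
    constant term of that determinant. *)
Lemma scoef_antidiag (F : numFieldType) (m n : nat) (G : 'M[F]_(m, n))
    (K : 'M[F]_(n, m)) : (m <= n)%N ->
  scoef (m + n) (char_poly (block_mx 0 G K 0)) m.*2 = \det (- (G *m K)).
Proof.
move=> lemn; rewrite /scoef -signr_odd odd_double expr0 mul1r.
pose Gp := map_mx polyC G; pose Kp := map_mx polyC K.
have chiE : char_poly (block_mx 0 G K 0) * 'X^m =
    \det ('X%:M *m 'X%:M - Gp *m Kp) * 'X^n.
  have -> : 'X^m = \det (block_mx 'X%:M 0 Kp 1%:M).
    by rewrite det_lblock det1 mulr1 det_scalar.
  rewrite -det_mulmx -[X in _ * X]det_scalar -(det_ublock _ (- Gp)).
  congr (\det _); rewrite /char_poly_mx map_block_mx !map_mx0 -/Gp -/Kp.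
  rewrite scalar_mx_block opp_block_mx add_block_mx oppr0 !addr0 !add0r mulmx_block.
  rewrite !mulmx0 !mulmx1 !add0r !mulNmx !subr0 (scalar_mxC _ Kp) addNr.
  by [].
have := congr1 (fun p : {poly F} => p`_n) chiE.
rewrite !coefMXn ltnNge lemn /= ltnn subnn.
rewrite (_ : m + n - m.*2 = n - m)%N; last by lia.
move=> ->; rewrite -horner_coef0 -horner_evalE -det_map_mx; congr (\det _).
apply/matrixP => i j; rewrite /Gp /Kp -map_mxM -scalar_mxM !mxE /= /horner_eval.
by rewrite hornerD hornerN hornerC hornerMn hornerM hornerX mul0r mul0rn add0r.
Qed.

Section BaseValue.
Local Open Scope sesquilinear_scope.
Local Open Scope complex_scope.

Definition commut (C : numClosedFieldType) (d : nat) (A B X : 'M[C]_d) : 'M[C]_d :=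
  A *m (X *m B *m X^t*) - (X *m B *m X^t*) *m A.

(** Taking the commutator with D cancels the diagonal blocks of the conjugated projection, so
    [scoef_antidiag] applies; [cauchy_binet] then splits the remaining Gram determinant of the lower
    block and brings in m!. *)
Lemma scoef_commut_prefix (C : numClosedFieldType) (m n : nat)
    (X : 'M[C]_(m + n)) (D := block_mx 1%:M 0 0 0 : 'M[C]_(m + n)) :
  (m <= n)%N ->
  scoef (m + n) (char_poly (commut D D X)) m.*2 *+ m`! =
  \sum_(f : {ffun 'I_m -> 'I_n})
    minor (@rshift m n \o f) X * minor (@lshift m n) X *
    (minor (@rshift m n \o f) X * minor (@lshift m n) X)^*%R.
Proof.
move=> lemn; rewrite /commut.
pose a := ulsubmx X; pose e := dlsubmx X.
have HE : X *m D *m X^t* = block_mx (a *m a^t*) (a *m e^t*) (e *m a^t*) (e *m e^t*).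
  rewrite -{1 2}[X]submxK tr_block_mx map_block_mx !mulmx_block.
  by rewrite !mulmx0 !mulmx1 !addr0 !mul0mx !addr0.
have cE : D *m (X *m D *m X^t*) - X *m D *m X^t* *m D =
    block_mx 0 (a *m e^t*) (- (e *m a^t*)) 0.
  rewrite HE !mulmx_block !(mul0mx, mulmx0, mul1mx, mulmx1, addr0) opp_block_mx.
  by rewrite add_block_mx subrr !oppr0 !addr0 !add0r.
rewrite cE (scoef_antidiag _ _ lemn).
rewrite mulmxN opprK !mulmxA -(mulmxA a) !det_mulmx.
have aJ : \det (a^t*) = (\det a)^*%R by rewrite det_map_mx det_tr.
rewrite aJ -mulrnAl -mulrnAr cauchy_binet mulr_sumr mulr_suml.
have -> : minor (@lshift m n) X = \det a.
  by congr (\det _); apply/matrixP => i j; rewrite !mxE.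
apply: eq_bigr => f _.
have -> : minor (@rshift m n \o f) X = \det (\matrix_(i, j) e (f i) j).
  by congr (\det _); apply/matrixP => i j; rewrite !mxE.
have -> : \det (\matrix_(i, j) (e^t*) i (f j)) =
    (\det (\matrix_(i, j) e (f i) j))^*%R.
  rewrite -det_map_mx -det_tr; congr (\det _).
  by apply/matrixP => i j; rewrite !mxE.
rewrite rmorphM /=; move: (\det a) (\det _) => x y.
by move: (x^*%R) (y^*%R) => x' y'; ring.
Qed.

Variables (R : realType) (disp : measure_display) (T : measurableType disp).
Variables (P : probability T R).
Local Notation C := R[i].

Lemma polymx_commut d (A B : 'M[C]_d) : polymx (commut A B).
Proof.
have pH : polymx (fun X : 'M[C]_d => X *m B *m X^t*).
  apply: polymx_mul; last exact: (polymx_trC (@polymx_id R d)).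
  exact: (polymx_mul (@polymx_id R d) (@polymx_cst R d _ _ B)).
exact: (polymxB (polymx_mul (@polymx_cst R d _ _ A) pH) (polymx_mul pH (@polymx_cst R d _ _ A))).
Qed.

Lemma polyfun_scoef_commut d (A B : 'M[C]_d) k : (k <= d)%N ->
  polyfun (fun X => scoef d (char_poly (commut A B X)) k).
Proof.
move=> lekd.
exact: (polyfun_comp (polyfun_scoef_char_poly _ lekd) (polymx_commut A B)).
Qed.

(** Rows taken from the last n all lie outside the first m, so [moment_outside] divides by m + 1 and
    cancels the numerator of [moment_lshift]; the 'C(n, m) * m! injections contribute equally. *)
Lemma E_scoef_commut_block m n (U : T -> 'M[C]_(m + n))
    (D := block_mx 1%:M 0 0 0 : 'M[C]_(m + n)) :
  haar_unitary P U -> (m <= n)%N ->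
  EU P U (fun X => scoef (m + n) (char_poly (commut D D X)) m.*2) =
  'C(n, m)%:R / ('C(m + n, m)%:R * 'C((m + n).+1, m)%:R).
Proof.
move=> hU lemn.
have m0 : m`!%:R != 0 :> C by rewrite pnatr_eq0 -lt0n fact_gt0.
have led : (m.*2 <= m + n)%N by lia.
apply: (mulfI m0); rewrite -(EUZ hU _ (polyfun_scoef_commut D D led)).
under boolp.eq_fun do rewrite mulr_natl scoef_commut_prefix //.
rewrite (EU_sum hU); last by move=> f; exact: polyfun_moment.
rewrite -/(moment _ _ _ _ _ _).
rewrite (bigID (fun f : {ffun _} => injectiveb f)) /= [X in _ + X]big1 ?addr0.
  have fE (f : {ffun 'I_m -> 'I_n}) : injectiveb f ->
      moment P U (@rshift m n \o f) (@lshift m n) (@rshift m n \o f) (@lshift m n) =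
      ('C(m + n, m)%:R * 'C((m + n).+1, m)%:R)^-1.
    move=> /injectiveP fI; rewrite (moment_outside hU).
    - rewrite (moment_lshift hU) (_ : outside _ _ = m).
        by rewrite mulrAC divff ?mul1r // pnatr_eq0.
      rewrite /outside -[RHS]card_ord; apply: eq_card => i; rewrite !inE.
      by rewrite mem_codom_lshift /= ltnNge leq_addr.
    - by move=> i j /rshift_inj/fI.
    - exact: lshift_inj.
  rewrite (eq_bigr _ fE) sumr_const.
  have -> : #|[pred f : {ffun 'I_m -> 'I_n} | injectiveb f]| = (n ^_ m)%N.
    by rewrite -[n in RHS]card_ord -[m in RHS]card_ord -card_inj_ffuns;
       apply: eq_card => f; rewrite !inE.
  by rewrite -bin_ffact -[LHS]mulr_natl natrM [_ * m`!%:R]mulrC -mulrA.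
move=> f /injectivePn[i [j nij fij]].
rewrite -(EU_cst P U 0); apply: (eq_EU hU) => X _.
by rewrite (@minor_noninj _ _ _ _ X i j nij) ?mul0r //= fij.
Qed.

End BaseValue.

(** * The commutator moment as a function of A and B *)

Section Commutators.
Local Open Scope sesquilinear_scope.
Local Open Scope complex_scope.
Variables (R : realType) (disp : measure_display) (T : measurableType disp).
Variables (P : probability T R) (d : nat) (U : T -> 'M[R[i]]_d).
Hypothesis hU : haar_unitary P U.
Variable k : nat.
Hypothesis lekd : (k <= d)%N.
Local Notation C := R[i].
Local Notation E := (EU P U).
Implicit Types (A B W : 'M[C]_d) (a b : 'I_d -> C).

Definition commut_moment A B : C := E (fun X => scoef d (char_poly (commut A B X)) k).

(** Conjugating A by W amounts to replacing X by W X, up to a conjugation of the whole commutator,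
    which its characteristic polynomial ignores. *)
Lemma commut_moment_conj A B W : W \is unitarymx ->
  commut_moment (W^t* *m A *m W) B = commut_moment A B.
Proof.
move=> uW; have WW : W^t* *m W = 1%:M by apply: mulmx1C; exact/unitarymxP.
rewrite -[RHS](EU_mull hU uW (polyfun_scoef_commut A B lekd)).
apply: (eq_EU hU) => X _.
have cE : commut (W^t* *m A *m W) B X = W^t* *m commut A B (W *m X) *m W.
  rewrite /commut trmx_mul map_mxM mulmxBr mulmxBl !mulmxA.
  by rewrite WW mul1mx -[X in _ = X - _]mulmxA WW mulmx1.
by rewrite cE (char_poly_conj _ WW).
Qed.

Lemma scoef_char_polyN A : scoef d (char_poly (- A)) k = (-1) ^+ k * scoef d (char_poly A) k.
Proof.
rewrite !scoef_char_poly // mulr_sumr; apply: eq_bigr => s _.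
rewrite mulr_sumr; apply: eq_bigr => S /eqP cS.
rewrite mulrCA -cS -prodrN; congr (_ * _); apply: eq_bigr => i _.
by rewrite mxE.
Qed.

(** The commutator of A with X B X^* is conjugate, through X, to minus that of B with X^* A X; the
    sign yields (-1)^k and [EU_trC] replaces X^* by X. *)
Lemma commut_moment_swap A B : commut_moment A B = (-1) ^+ k * commut_moment B A.
Proof.
rewrite -[commut_moment B A](EU_trC hU (polyfun_scoef_commut B A lekd)).
have pT := polyfun_comp (polyfun_scoef_commut B A lekd)
  (polymx_trC (@polymx_id R d)).
rewrite -(EUZ hU _ pT); apply: (eq_EU hU) => X uX.
have XX : X *m X^t* = 1%:M by exact/unitarymxP.
have cE : commut A B X = X *m (- commut B A (X^t*)) *m X^t*.
  rewrite /commut trmxCK mulmxN mulNmx mulmxBr mulmxBl opprB !mulmxA XX mul1mx.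
  by rewrite -[X in _ = _ - X]mulmxA XX mulmx1.
by rewrite cE (char_poly_conj _ XX) scoef_char_polyN.
Qed.

Definition diagf a : 'M[C]_d := diag_mx (\row_i a i).

Lemma commut_moment_diag a B : commut_moment (diagf a) B =
  diff_form k (fun s S => E (fun X => (-1) ^+ s * (\prod_(i in ~: S) (i == s i)%:R) *
    \prod_(i in S) (X *m B *m X^t*) i (s i))) a.
Proof.
have pH : polymx (fun X : 'M[C]_d => X *m B *m X^t*).
  apply: polymx_mul; last exact: (polymx_trC (@polymx_id R d)).
  exact: (polymx_mul (@polymx_id R d) (@polymx_cst R d _ _ B)).
have pS (s : 'S_d) (S : {set 'I_d}) : polyfun (fun X : 'M[C]_d =>
    (-1) ^+ s * (\prod_(i in ~: S) (i == s i)%:R) *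
    \prod_(i in S) (X *m B *m X^t*) i (s i)).
  apply: (polyfunM (polyfun_cst _ _)); apply: polyfun_prod => i; exact: pH.
have pSa (s : 'S_d) (S : {set 'I_d}) : polyfun (fun X : 'M[C]_d =>
    (-1) ^+ s * (\prod_(i in ~: S) (i == s i)%:R) *
    (\prod_(i in S) (X *m B *m X^t*) i (s i)) * \prod_(i in S) (a i - a (s i))).
  exact: (polyfunM (pS s S) (polyfun_cst _ _)).
transitivity (\sum_(s : 'S_d) \sum_(S : {set 'I_d} | #|S| == k) E (fun X : 'M[C]_d =>
    (-1) ^+ s * (\prod_(i in ~: S) (i == s i)%:R) *
    (\prod_(i in S) (X *m B *m X^t*) i (s i)) * \prod_(i in S) (a i - a (s i)))).
  transitivity (E (fun X : 'M[C]_d =>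
    \sum_(s : 'S_d) \sum_(S : {set 'I_d} | #|S| == k)
    (-1) ^+ s * (\prod_(i in ~: S) (i == s i)%:R) *
    (\prod_(i in S) (X *m B *m X^t*) i (s i)) * \prod_(i in S) (a i - a (s i)))).
    apply: (eq_EU hU) => X _; rewrite scoef_char_poly //.
    apply: eq_bigr => s _; apply: eq_bigr => S _; rewrite -[RHS]mulrA -big_split /=.
    congr (_ * _); apply: eq_bigr => i _; rewrite /commut /diagf mxE.
    by rewrite mul_diag_mx mxE mxE mul_mx_diag !mxE; ring.
  rewrite (EU_sum hU); last by move=> s; exact: (polyfun_sum _ _ (pSa s)).
  by apply: eq_bigr => s _; rewrite (EU_sum hU _ _ (pSa s)).
by apply: eq_bigr => s _; apply: eq_bigr => S _; rewrite (EUMr hU _ (pS s S)).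
Qed.

Lemma diagf_perm a (t : 'S_d) :
  diagf (a \o t) = (perm_mx (t^-1)%g)^t* *m diagf a *m perm_mx (t^-1)%g.
Proof.
rewrite tr_perm_mx map_perm_mx invgK -row_permE.
rewrite -[t in RHS]invgK -col_permE invgK.
apply/matrixP => i j; rewrite !mxE /=.
by rewrite (inj_eq (@perm_inj _ t)).
Qed.

Lemma commut_moment_diag_perm B a (t : 'S_d) :
  commut_moment (diagf (a \o t)) B = commut_moment (diagf a) B.
Proof.
rewrite diagf_perm commut_moment_conj //; apply/unitarymxP.
by rewrite tr_perm_mx map_perm_mx -perm_mxM mulgV perm_mx1.
Qed.

Lemma commut_moment_odd a B : odd k -> commut_moment (diagf a) B = 0.
Proof.
move=> ok; rewrite commut_moment_diag; apply: diff_form_eq0 => // [b t|].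
  by rewrite -!commut_moment_diag commut_moment_diag_perm.
by rewrite ok.
Qed.

Lemma commut_moment_even a B m : k = m.*2 ->
  sym_diff k (@prefix01 C d m) * commut_moment (diagf a) B =
  sym_diff k a * commut_moment (diagf (@prefix01 C d m)) B.
Proof.
move=> km; rewrite !commut_moment_diag; apply: diff_form_even => // b t.
by rewrite -!commut_moment_diag commut_moment_diag_perm.
Qed.

End Commutators.

(** * Coefficients of the polynomial convolutions *)

Lemma coef_sum_descending (F : nzRingType) (d k : nat) (c : nat -> F) : (k <= d)%N ->
  (\sum_(j < d.+1) c j *: 'X^(d - j))`_(d - k) = c k.
Proof.
move=> lekd; rewrite coef_sum (bigD1 (Ordinal (lekd : (k < d.+1)%N))) //= big1.
  by rewrite coefZ coefXn eqxx mulr1 addr0.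
move=> j; rewrite -val_eqE /= => njk; rewrite coefZ coefXn.
have -> : (d - k == d - j)%N = false by have := ltn_ord j; lia.
by rewrite mulr0.
Qed.

Lemma scoef_boxminus (F : fieldType) (d k : nat) (p q : {poly F}) : (k <= d)%N ->
  scoef d (boxminus d p q) k = \sum_(i < k.+1) (-1) ^+ (k - i) *
    (((d - i)`! * (d - (k - i))`!)%:R / (d`! * (d - k)`!)%:R) *
    scoef d p i * scoef d q (k - i).
Proof.
move=> lekd; rewrite {1}/scoef (@coef_sum_descending F d k (fun k => (-1) ^+ k *
  \sum_(i < k.+1) (-1) ^+ (k - i) *
    (((d - i)`! * (d - (k - i))`!)%:R / (d`! * (d - k)`!)%:R) *
    scoef d p i * scoef d q (k - i))) //.
by rewrite signrMK.
Qed.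

Lemma scoef_boxtimes (F : fieldType) (d k : nat) (p q : {poly F}) : (k <= d)%N ->
  scoef d (boxtimes d p q) k = scoef d p k * scoef d q k / 'C(d, k)%:R.
Proof.
move=> lekd; rewrite {1}/scoef (@coef_sum_descending F d k (fun k => (-1) ^+ k *
  (scoef d p k * scoef d q k / 'C(d, k)%:R))) //.
by rewrite signrMK.
Qed.

Lemma scoef_zpoly (F : fieldType) (d k : nat) : (k <= d)%N ->
  scoef d (zpoly F d) k = if odd k then 0 else
    'C(d, k)%:R * (d ^_ k./2)%:R * (k./2`!%:R / k`!%:R) *
    ((d + 1 - k./2)%:R / (d + 1)%:R).
Proof.
move=> lekd; rewrite /scoef /zpoly coef_sum.
have [ok|ek] := boolP (odd k).
  rewrite big1 ?mulr0 // => j _; rewrite coefZ coefXn.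
  have -> : (d - k == d - 2 * j)%N = false by have := ltn_ord j; lia.
  by rewrite mulr0.
rewrite -signr_odd (negPf ek) expr0 mul1r.
have ltk : (k./2 < (d./2).+1)%N by lia.
rewrite (bigD1 (Ordinal ltk)) //= big1 ?addr0 => [|j].
  have -> : (2 * k./2 = k)%N by lia.
  by rewrite coefZ coefXn eqxx mulr1.
rewrite -val_eqE /= => njk; rewrite coefZ coefXn.
have -> : (d - k == d - 2 * j)%N = false by have := ltn_ord j; lia.
by rewrite mulr0.
Qed.

(** * Reduction of normal matrices to the projection case *)

Section NormalMatrices.
Local Open Scope sesquilinear_scope.
Local Open Scope complex_scope.
Variables (R : realType) (disp : measure_display) (T : measurableType disp).
Variables (P : probability T R).
Local Notation C := R[i].

Lemma diagf_prefix01 (m n : nat) :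
  diagf (@prefix01 C (m + n) m) = block_mx 1%:M 0 0 0.
Proof.
apply/matrixP => i j.
case: (split_ordP i) => i' ->; case: (split_ordP j) => j' ->.
- by rewrite block_mxEul !mxE eq_lshift /prefix01 /= ltn_ord.
- by rewrite block_mxEur !mxE eq_lrshift mulr0n.
- by rewrite block_mxEdl !mxE eq_rlshift mulr0n.
- by rewrite block_mxEdr !mxE /prefix01 /= ltnNge leq_addr mul0rn.
Qed.

Lemma commut_moment_prefix01 (d m : nat) (U : T -> 'M[C]_d) :
  haar_unitary P U -> (m.*2 <= d)%N ->
  commut_moment P U m.*2 (diagf (@prefix01 C d m)) (diagf (@prefix01 C d m)) =
  'C(d - m, m)%:R / ('C(d, m)%:R * 'C(d.+1, m)%:R).
Proof.
(* Substituting m + n for d gives the matrices their block type without casts. *)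
move=> hU led; have dE : d = (m + (d - m))%N by lia.
move: (d - m)%N dE => n dE; subst d.
rewrite diagf_prefix01; apply: (E_scoef_commut_block hU); lia.
Qed.

Lemma normalmx_diagf (d : nat) (A : 'M[C]_d) : A \is normalmx ->
  exists (W : 'M[C]_d) (a : 'I_d -> C),
    W \is unitarymx /\ A = W^t* *m diagf a *m W.
Proof.
move=> /orthomx_spectralP AE.
exists (spectralmx A), (fun i => spectral_diag A 0 i).
split; first exact: spectral_unitarymx.
rewrite {1}AE invmx_unitary ?spectral_unitarymx //; congr (_ *m diag_mx _ *m _).
by apply/rowP => i; rewrite mxE.
Qed.

Lemma elemsym_conj_diagf (d k : nat) (W : 'M[C]_d) (a : 'I_d -> C) :
  W \is unitarymx -> (k <= d)%N ->
  elemsym k (W^t* *m diagf a *m W) = elem_sym a k.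
Proof.
move=> uW lekd; have WW : W^t* *m W = 1%:M by apply: mulmx1C; exact/unitarymxP.
rewrite elemsym_scoef // (char_poly_conj _ WW) char_poly_trig; last first.
  exact: diag_mx_is_trig.
rewrite -scoef_prod_XsubC //; congr (scoef _ _ _); apply: eq_bigr => i _.
by rewrite !mxE eqxx.
Qed.

(** For even k, proportionality is applied in A, and then in B after a swap. With D the projection
    on the first k/2 coordinates and s0 the nonzero value of [sym_diff] there, s0^2 M(A, B) is the
    product of the two sums with M(D, D). *)
Lemma commut_moment_normal (d k : nat) (U : T -> 'M[C]_d) (A B : 'M[C]_d) :
  haar_unitary P U -> A \is normalmx -> B \is normalmx -> (k <= d)%N ->
  commut_moment P U k A B = if odd k then 0 else
      (\sum_(i < k.+1)
         (-1) ^+ i *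
         (((d - i)`! * (d - (k - i))`!)%:R / (d`! * (d - k)`!)%:R) *
         elemsym i A * elemsym (k - i) A) *
      (\sum_(i < k.+1)
         (-1) ^+ i *
         (((d - i)`! * (d - (k - i))`!)%:R / (d`! * (d - k)`!)%:R) *
         elemsym i B * elemsym (k - i) B) *
      ((d - k)`!%:R / (d - k./2)`!%:R) * (k./2)`!%:R *
      ((d + 1 - k./2)%:R / (d + 1)%:R).
Proof.
move=> hU /normalmx_diagf[V [a [uV AE]]] /normalmx_diagf[W [b [uW BE]]] lekd.
have sE (M Z : 'M[C]_d) (c : 'I_d -> C) : Z \is unitarymx ->
    M = Z^t* *m diagf c *m Z ->
    \sum_(i < k.+1) (-1) ^+ i *
      (((d - i)`! * (d - (k - i))`!)%:R / (d`! * (d - k)`!)%:R) *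
      elemsym i M * elemsym (k - i) M = sym_diff k c.
  move=> uZ ->; rewrite sym_diffE //; apply: eq_bigr => i _.
  by rewrite !elemsym_conj_diagf //; have := ltn_ord i; lia.
transitivity (if odd k then 0 else sym_diff k a * sym_diff k b *
    ((d - k)`!%:R / (d - k./2)`!%:R) * (k./2)`!%:R *
    ((d + 1 - k./2)%:R / (d + 1)%:R)); last first.
  by rewrite -(sE _ _ _ uV AE) -(sE _ _ _ uW BE).
rewrite AE (commut_moment_conj hU lekd _ _ uV) {sE}.
case: ifPn => [|/negPf ek]; first exact: commut_moment_odd.
have [m km] : exists m, k = m.*2 by exists k./2; lia.
have -> : k./2 = m by lia.
pose D := diagf (@prefix01 C d m); pose s0 := sym_diff k (@prefix01 C d m).
have E1 : s0 * commut_moment P U k (diagf a) B =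
    sym_diff k a * commut_moment P U k D B by exact: commut_moment_even.
have E2 : commut_moment P U k D B = commut_moment P U k (diagf b) D.
  rewrite (commut_moment_swap hU lekd) -signr_odd ek expr0 mul1r BE.
  exact: commut_moment_conj.
have E3 : s0 * commut_moment P U k (diagf b) D =
    sym_diff k b * commut_moment P U k D D by exact: commut_moment_even.
have E4 : commut_moment P U k D D = 'C(d - m, m)%:R / ('C(d, m)%:R * 'C(d.+1, m)%:R).
  move: lekd; rewrite /D km => led; exact: commut_moment_prefix01.
(* The sign (-1)^m of s0 disappears in the square. *)
have s0E : s0 * s0 = (((d - m)`! ^ 2)%:R / (d`! * (d - k)`!)%:R) ^+ 2.
  rewrite /s0 (sym_diff_prefix01 _ lekd km) -expr2 -mulrA exprMn.
  by rewrite -exprM mulnC exprM sqrrN expr1n expr1n mul1r.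
have f0 j : j`!%:R != 0 :> C by rewrite pnatr_eq0 -lt0n fact_gt0.
have s0N : s0 * s0 != 0.
  by rewrite s0E expf_neq0 // mulf_neq0 ?invr_eq0 ?natrM ?mulf_neq0 // natrX expf_neq0.
have L : s0 * s0 * commut_moment P U k (diagf a) B = sym_diff k a *
    (sym_diff k b * ('C(d - m, m)%:R / ('C(d, m)%:R * 'C(d.+1, m)%:R))).
  by rewrite -[LHS]mulrA E1 mulrCA E2 E3 E4.
apply: (mulfI s0N); rewrite [LHS]L s0E.
have C1 : 'C(d - m, m)%:R = (d - m)`!%:R / (m`!%:R * (d - k)`!%:R) :> C.
  have le1 : (m <= d - m)%N by lia.
  rewrite -(bin_fact le1) (_ : d - m - m = d - k)%N; last by lia.
  by rewrite !natrM mulfK // mulf_neq0.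
have C2 : 'C(d, m)%:R = d`!%:R / (m`!%:R * (d - m)`!%:R) :> C.
  have le1 : (m <= d)%N by lia.
  by rewrite -(bin_fact le1) !natrM mulfK // mulf_neq0.
have C3 : 'C(d.+1, m)%:R =
    (d + 1)%:R * d`!%:R / (m`!%:R * ((d + 1 - m)%:R * (d - m)`!%:R)) :> C.
  have le1 : (m <= d.+1)%N by lia.
  rewrite addn1 -natrM -factS -(bin_fact le1) !natrM.
  rewrite (_ : d.+1 - m = (d - m).+1)%N; last by lia.
  by rewrite factS natrM mulfK // !mulf_neq0 // pnatr_eq0.
have n1 : (d + 1)%:R != 0 :> C by rewrite pnatr_eq0; lia.
have n2 : (d + 1 - m)%:R != 0 :> C by rewrite pnatr_eq0; lia.
rewrite C1 C2 C3 natrX natrM.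
move: (sym_diff k a) (sym_diff k b) (f0 (d - m)%N) (f0 m) (f0 d) (f0 (d - k)%N) n1 n2.
clear; move: ((d - m)`!%:R) (m`!%:R) (d`!%:R) ((d - k)`!%:R) ((d + 1)%:R) ((d + 1 - m)%:R).
move=> x1 x2 x3 x4 x5 x6 x y h1 h2 h3 h4 h5 h6.
by field; rewrite h1 h2 h3 h4 h5 h6.
Qed.

End NormalMatrices.

(** * Assembly of the expected characteristic polynomial *)

Local Open Scope classical_set_scope.
Local Open Scope complex_scope.
Local Open Scope sesquilinear_scope.

Theorem theorem1p5 (R : realType) (disp : measure_display)
    (T : measurableType disp) (P : probability T R) (d : nat)
    (A B : 'M[R[i]]_d) (U : T -> 'M[R[i]]_d) :
  (1 <= d)%N ->
  A \is normalmx -> B \is normalmx ->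
  haar_unitary P U ->
  let X : T -> 'M[R[i]]_d := fun t =>
    A *m U t *m B *m (U t)^t* - U t *m B *m (U t)^t* *m A in
  let p : {poly R[i]} := char_poly A in
  let q : {poly R[i]} := char_poly B in
  expectationP P d (fun t => char_poly (X t)) =
    boxtimes d (boxtimes d (boxminus d p p) (boxminus d q q)) (zpoly _ d)
  /\
  (forall k : nat, (k <= d)%N ->
    expectationC P (fun t => elemsym k (X t)) =
    if odd k then 0 else
      (\sum_(i < k.+1)
         (-1) ^+ i *
         (((d - i)`! * (d - (k - i))`!)%:R / (d`! * (d - k)`!)%:R) *
         elemsym i A * elemsym (k - i) A) *
      (\sum_(i < k.+1)
         (-1) ^+ i *
         (((d - i)`! * (d - (k - i))`!)%:R / (d`! * (d - k)`!)%:R) *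
         elemsym i B * elemsym (k - i) B) *
      ((d - k)`!%:R / (d - k./2)`!%:R) * (k./2)`!%:R *
      ((d + 1 - k./2)%:R / (d + 1)%:R)).
Proof.
move=> d0 nA nB hU X p q.
have XE t : X t = commut A B (U t) by rewrite /X /commut !mulmxA.
have EX k : (k <= d)%N ->
    expectationC P (fun t => scoef d (char_poly (X t)) k) = commut_moment P U k A B.
  by move=> lekd; under boolp.eq_fun do rewrite XE.
split=> [|k lekd]; last first.
  under boolp.eq_fun do rewrite elemsym_scoef //.
  by rewrite EX // commut_moment_normal.
apply/polyP => j; rewrite coef_poly; case: ltnP => [ltjd|ltdj]; last first.
  rewrite coef_sum big1 // => k _; rewrite coefZ coefXn.
  have -> : (j == d - k)%N = false by lia.
  by rewrite mulr0.
have [k lekd ->] : exists2 k, (k <= d)%N & j = (d - k)%N by exists (d - j)%N; lia.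
have coefE (r : {poly R[i]}) : r`_(d - k) = (-1) ^+ k * scoef d r k.
  by rewrite /scoef signrMK.
under boolp.eq_fun do rewrite coefE XE.
rewrite coefE -/(EU P U (fun Y => (-1) ^+ k * scoef d (char_poly (commut A B Y)) k)).
rewrite (EUZ hU _ (polyfun_scoef_commut A B lekd)) -/(commut_moment P U k A B).
congr (_ * _); rewrite commut_moment_normal // scoef_boxtimes // scoef_boxtimes //.
rewrite scoef_zpoly //; case: ifPn => [_|ek]; first by rewrite mulr0 mul0r.
have sE (M : 'M[R[i]]_d) : scoef d (boxminus d (char_poly M) (char_poly M)) k =
    \sum_(i < k.+1) (-1) ^+ i *
      (((d - i)`! * (d - (k - i))`!)%:R / (d`! * (d - k)`!)%:R) *
      elemsym i M * elemsym (k - i) M.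
  (* [boxminus] carries the sign (-1)^(k - i) where the sums have (-1)^i; these agree because k is
     even. *)
  rewrite scoef_boxminus //; apply: eq_bigr => i _.
  have leik : (i <= k)%N by rewrite -ltnS.
  rewrite !elemsym_scoef ?(leq_trans leik) ?(leq_trans (leq_subr _ _)) //.
  by rewrite -signr_odd oddB // (negPf ek) /= signr_odd.
have f0 n : n`!%:R != 0 :> R[i] by rewrite pnatr_eq0 -lt0n fact_gt0.
have C0 : 'C(d, k)%:R != 0 :> R[i] by rewrite pnatr_eq0 -lt0n bin_gt0.
have le2 : (k./2 <= d)%N by lia.
have fE : (d ^_ k./2)%:R = d`!%:R / (d - k./2)`!%:R :> R[i].
  by rewrite -(ffact_fact le2) natrM mulfK.
have kE : d`!%:R = 'C(d, k)%:R * (k`!%:R * (d - k)`!%:R) :> R[i].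
  by rewrite -(bin_fact lekd) !natrM.
(* Of the two divisions by 'C(d, k), one for each [boxtimes], one cancels the binomial of [zpoly]
   and the other combines with d ^_ (k/2) and 1 / k! into (d - k)! / (d - k/2)!. *)
have fin (x y : R[i]) : x * y * ((d - k)`!%:R / (d - k./2)`!%:R) * k./2`!%:R *
    ((d + 1 - k./2)%:R / (d + 1)%:R) =
    x * y / 'C(d, k)%:R * ('C(d, k)%:R * (d ^_ k./2)%:R * (k./2`!%:R / k`!%:R) *
    ((d + 1 - k./2)%:R / (d + 1)%:R)) / 'C(d, k)%:R.
  rewrite fE kE; move: (f0 (d - k./2)%N) (f0 k) C0.
  move: ((d - k./2)`!%:R) (k`!%:R) ((d - k)`!%:R) ('C(d, k)%:R) (k./2`!%:R)
    ((d + 1 - k./2)%:R / (d + 1)%:R) => x1 x2 x3 x4 x5 x6 h1 h2 h4.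
  by field; rewrite h1 h2 h4.
rewrite fin; exact: (congr2 (fun x y => x * y / 'C(d, k)%:R *
  ('C(d, k)%:R * (d ^_ k./2)%:R * (k./2`!%:R / k`!%:R) *
  ((d + 1 - k./2)%:R / (d + 1)%:R)) / 'C(d, k)%:R) (esym (sE A)) (esym (sE B))).
Qed.
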